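(* Let $\varphi\in\mathcal G_{>0}$ with $\mathrm{char}(\varphi)\ge2$. Assume that there exists $\varepsilon>0$ such that $\varphi(\mathbb C_0)\subset\mathbb C_\varepsilon$. Then the composition operator $C_\varphi$ on $\mathcal H^2$ fails to have a minimal commutant.
   Context: For $\theta\in\mathbb R$, $\mathbb C_\theta=\{s\in\mathbb C:\mathrm{Re}\,s>\theta\}$. $\mathcal{G}_{>0}$ is the set of maps $\varphi(s)=c_0s+\psi(s)$ where $c_0\ge1$ is an integer (the characteristic, $\mathrm{char}(\varphi)=c_0$), $\psi$ is a Dirichlet series $\sum_{n\ge1}c_nn^{-s}$ converging uniformly in $\mathbb C_\varepsilon$ for every $\varepsilon>0$, and either $\psi\equiv i\tau$ for some $\tau\in\mathbb R$ or $\psi(\mathbb C_0)\subset\mathbb C_0$; such $\varphi$ is a self-map of $\mathbb C_0$ (and of $\mathbb C_{1/2}$). $\mathcal H^2$ is the Hilbert space of Dirichlet series $f(s)=\sum_{n\ge1}a_nn^{-s}$ with $\|f\|=(\sum|a_n|^2)^{1/2}<\infty$; its elements are analytic on $\mathbb C_{1/2}$. For $\varphi\in\mathcal G_{>0}$, $C_\varphi f=f\circ\varphi$ is a bounded operator on $\mathcal H^2$ (Gordon-Hedenmalm). For a bounded operator $A$ on a Hilbert space $H$, $\{A\}'=\{T\in\mathcal B(H):TA=AT\}$, $\mathrm{alg}(A)=\{p(A):p\text{ a polynomial}\}$, and $A$ has a minimal commutant if $\overline{\mathrm{alg}(A)}^{\sigma}=\{A\}'$, where $\sigma$ denotes the weak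 operator topology. *)

(* Defs.v *)
From HB Require Import structures.
From mathcomp Require Import all_boot all_order all_algebra.
From mathcomp Require Import all_classical all_reals all_analysis.
From mathcomp Require Import complex.
From mathcomp Require Import ring.

Set Implicit Arguments.
Unset Strict Implicit.
Unset Printing Implicit Defensive.

Import Order.TTheory GRing.Theory Num.Theory.
Import numFieldNormedType.Exports.
Import Normc.

Local Open Scope classical_set_scope.
Local Open Scope complex_scope.
Local Open Scope ring_scope.

(* R[i] receives the topology of its complex modulus; the library puts it only
   on abstract number fields and on the regular module R[i]^o. *)
HB.instance Definition _ (R : realType) := NormedModule.copy R[i] R[i]^o.

Section DirichletSeries.
Variable R : realType.
Implicit Types (a : nat -> R[i]) (s z : R[i]) (n : nat).

Definition half_plane (theta : R) : set R[i] := [set s | theta < complex.Re s].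

Definition expC z : R[i] :=
  (expR (complex.Re z))%:C * (cos (complex.Im z) +i* sin (complex.Im z)).

(* [npow n s] is n^{-s} = exp (- s log n), meant for n >= 1. *)
Definition npow n s : R[i] := expC (- (s * (ln n%:R)%:C)).

(* Coefficient sequences are indexed from 0: [a n] is the coefficient of
   (n+1)^{-s}. *)
Definition dirichlet_partial a (N : nat) (s : R[i]) : R[i] :=
  \sum_(0 <= n < N) a n * npow n.+1 s.

Definition dirichlet_sum a s : R[i] :=
  limn (fun N => dirichlet_partial a N s).

(* The class G_{>0}: maps s |-> c0 s + psi(s). *)
Record Gpos := MkGpos {
  char : nat;
  Gcoef : nat -> R[i];
  char_ge1 : (1 <= char)%N;
  Gcoef_unif : forall eps : R, 0 < eps ->
    {uniform half_plane eps,
       dirichlet_partial Gcoef @ \oo --> dirichlet_sum Gcoef};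
  Gcoef_range :
    (exists tau : R, forall s, half_plane 0 s ->
       dirichlet_sum Gcoef s = 0 +i* tau)
    \/ dirichlet_sum Gcoef @` half_plane 0 `<=` half_plane 0 }.

Definition Gfun (phi : Gpos) s : R[i] :=
  (char phi)%:R * s + dirichlet_sum (Gcoef phi) s.

End DirichletSeries.

Coercion Gfun : Gpos >-> Funclass.

Section HardySpace.
Variable R : realType.
Implicit Types a : nat -> R[i].

Definition sqnorm a : \bar R := (\sum_(n <oo) (normc (a n) ^+ 2)%:E)%E.

Definition sqsummable : {pred (nat -> R[i])} :=
  fun a => (sqnorm a < +oo)%E.

Lemma sqsummable_submod : submod_closed sqsummable.
Proof.
have sq_ge0 a n : (0 <= (normc (a n) ^+ 2)%:E)%E by rewrite lee_fin sqr_ge0.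
split=> [|k a b].
  rewrite unfold_in /sqnorm eseries0 ?ltry// => n _ _.
  by rewrite normc0 expr0n.
rewrite !unfold_in => ha hb.
have le_n n : ((normc ((k *: a + b) n) ^+ 2)%:E <=
    (2 * normc k ^+ 2)%:E * (normc (a n) ^+ 2)%:E +
    2%:E * (normc (b n) ^+ 2)%:E)%E.
  rewrite -!EFinM -EFinD lee_fin.
  have := le_normcD (k * a n) (b n); rewrite normcM => le1.
  have ge0 (z : R[i]) : 0 <= normc z.
    by case: z => x y; rewrite /normc sqrtr_ge0.
  have le2 := lerXn2r 2 (ge0 _) (addr_ge0 (mulr_ge0 (ge0 k) (ge0 (a n)))
    (ge0 (b n))) le1.
  apply: (le_trans le2); rewrite -subr_ge0.
  have -> : 2 * normc k ^+ 2 * normc (a n) ^+ 2 + 2 * normc (b n) ^+ 2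
    - (normc k * normc (a n) + normc (b n)) ^+ 2
    = (normc k * normc (a n) - normc (b n)) ^+ 2.
    rewrite sqrrB sqrrD !exprMn -mulrA !mulr2n !mulrDl !mul1r.
    by rewrite !opprD !addrA; ring.
  exact: sqr_ge0.
have c_ge0 : (0 <= (2 * normc k ^+ 2)%:E)%E.
  by rewrite lee_fin mulr_ge0 ?sqr_ge0.
have : (sqnorm (k *: a + b)%R <=
    (2 * normc k ^+ 2)%:E * sqnorm a + 2%:E * sqnorm b)%E.
  rewrite /sqnorm -!nneseriesZl// -nneseriesD//.
  - by apply: lee_nneseries.
  - by move=> n _ _; exact: mule_ge0.
  - by move=> n _ _; apply: mule_ge0 => //; rewrite lee_fin.
move/le_lt_trans; apply; rewrite lte_add_pinfty// lte_mul_pinfty ?lee_fin//.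
Qed.

HB.instance Definition _ :=
  GRing.isSubmodClosed.Build R[i] (nat -> R[i]) sqsummable sqsummable_submod.

(* H^2, each Dirichlet series being identified with its coefficients. *)
Record H2 := MkH2 { H2coef :> nat -> R[i]; _ : H2coef \in sqsummable }.

HB.instance Definition _ := [isSub for H2coef].
HB.instance Definition _ := [Choice of H2 by <:].
HB.instance Definition _ := [SubChoice_isSubLmodule of H2 by <:].

Definition H2eval (f : H2) (s : R[i]) : R[i] := dirichlet_sum f s.

Definition H2norm (f : H2) : R := Num.sqrt (fine (sqnorm f)).

Definition H2dot (f g : H2) : R[i] :=
  limn (fun N => \sum_(0 <= n < N) f n * (g n)^*).

(* The algebra B(H^2). *)
Record bop := MkBop {
  bop_fun :> {linear H2 -> H2};
  bop_bounded : exists M : R, forall f, H2norm (bop_fun f) <= M * H2norm f }.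

HB.instance Definition _ := gen_eqMixin bop.
HB.instance Definition _ := gen_choiceMixin bop.

(* The weak operator topology is the coarsest one making all the maps
   T |-> <T f, g> continuous. *)
Definition matrix_coef (T : bop) : {ptws (H2 * H2)%type -> R[i]} :=
  fun fg => H2dot (T fg.1) fg.2.

Definition wot := initial_topology matrix_coef.

Definition commutant (A : bop) : set wot :=
  [set T : bop | forall f : H2, T (A f) = A (T f)].

Definition alg (A : bop) : set wot :=
  [set T : bop | exists p : {poly R[i]},
     forall f : H2, T f = \sum_(k < size p) p`_k *: iter k A f].

Definition minimal_commutant (A : bop) : Prop :=
  closure (alg A) = commutant A.

(* The bounded operator A is C_phi : f |-> f o phi. *)
Definition is_composition_operator (phi : Gpos R) (A : bop) : Prop :=
  forall (f : H2) (s : R[i]), half_plane 2^-1 s ->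
    H2eval (A f) s = H2eval f (phi s).

End HardySpace.

(* Main.v *)
From HB Require Import structures.
Require Import Defs.
From mathcomp Require Import all_boot all_order all_algebra.
From mathcomp Require Import all_classical all_reals all_analysis.
From mathcomp Require Import complex.
From mathcomp Require Import ring lra zify.

Set Implicit Arguments.
Unset Strict Implicit.
Unset Printing Implicit Defensive.

Import Order.TTheory GRing.Theory Num.Theory.
Import numFieldNormedType.Exports.
Import Normc.

Local Open Scope classical_set_scope.
Local Open Scope complex_scope.
Local Open Scope ring_scope.

(** Write [C] for [C_phi], [c0] for the characteristic of [phi], and [n^(-s)] for
the monomials.  The weak closure of the polynomials in [C] is contained in the
commutant of [C]; the proof builds a bounded operator [T] that commutes with [C]
and has a nonzero matrix coefficient at a place where all powers of [C] have the
coefficient 0.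

The symbol fixes infinity and behaves there like [c0 s], with [c0 >= 2].  It can
therefore be linearized: there is a map [tau(s) = s + v(s)], [v] bounded, on some
half-plane, with [phi(tau(s)) = tau(c0 s)] ([exists_linearizer]).  If [gamma_n(f)]
denotes the coefficient of [n^(-s)] in [f o tau], this identity says that
[gamma_m(C f) = gamma_n(f)] when [m = n^c0], and that [gamma_m(C f) = 0] when [m] is
not a [c0]-th power ([pull_coef_comp], [pull_coef_comp0]).  Hence the functionals
[g_k = gamma_m], [m = 2^(c0^k)], satisfy [g_0 C = 0] and [g_(k+1) C = g_k], and for
every vector [u] the series
<<
    T f = sum_k g_k(f) C^k u
>>
commutes with [C], provided that it converges ([chain_op_comm]).  A coefficient on
the line [Re s = x] is at most [m^x] times a supremum, so that [g_k] has norm at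
most [2 (2^x)^(c0^k)] ([chain_le]).  On the other side, let [u = N^(-s)].  As [phi]
maps the right half-plane into [Re s > eps], and [Re phi(s) >= c0 Re s], the
function [C^(k+1) u = N^(-phi^(k+1))] is bounded by [N^(-eps c0^k)], and so is its
norm ([H2norm_iter_comp]).  Both rates are exponential in [c0^k], and the second one
wins for [N] large ([chain_decay]).

Choose [N] odd.  The vectors [C^k 2^(-s) = 2^(-phi^k)] have even frequencies only
([iter_comp_even]), whereas the coefficient of [N^(-s)] in [T 2^(-s)] is
[g_0(2^(-s))], because [C^k u] with [k >= 1] has frequencies larger than [N]
([iter_comp_support]).  This is the constant term of [2^(-v)], which is not 0 since
[2^(-v)] is invertible ([pull_coef_mono]).

The functions [psi], [v], [N^(-phi^k)] and [f o tau] have to possess Dirichlet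
coefficients that obey the expected rules, without being given as series.  They are
handled as uniform limits of Dirichlet polynomials on half-planes ([bohr]), a class
closed under products, exponentials and composition with symbols.  Coefficients are
mean values on vertical lines ([is_coef]), for which Bessel's inequality holds; the
means are taken over finite sets of equally spaced points. *)

(** * The complex exponential *)

Section ComplexExponential.
Variable R : realType.
Implicit Types (x y : R) (z w : R[i]).

Lemma normc_ge0 z : 0 <= normc z.
Proof. by case: z => x y; rewrite /normc sqrtr_ge0. Qed.

Lemma normcB z w : normc (z - w) <= normc z + normc w.
Proof. by rewrite -(normcN w) le_normcD. Qed.

Lemma normc_distC z w : normc (z - w) = normc (w - z).
Proof. by rewrite -normcN opprB. Qed.

Lemma normc_distD t z w : normc (z - w) <= normc (z - t) + normc (t - w).
Proof. by rewrite (_ : z - w = (z - t) + (t - w)) ?le_normcD// addrA subrK. Qed.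

Lemma normc_real x : normc x%:C = `|x|.
Proof. by rewrite /normc /= expr0n /= addr0 sqrtr_sqr. Qed.

Lemma normc_nat n : normc (n%:R : R[i]) = n%:R.
Proof. by rewrite -(rmorph_nat (real_complex R)) normc_real ger0_norm. Qed.

Lemma normcX z n : normc (z ^+ n) = normc z ^+ n.
Proof.
elim: n => [|n IH]; first by rewrite !expr0 normc1.
by rewrite !exprS normcM IH.
Qed.

Lemma normc_sum (I : Type) (r : seq I) (P : pred I) (F : I -> R[i]) :
  normc (\sum_(i <- r | P i) F i) <= \sum_(i <- r | P i) normc (F i).
Proof.
elim/big_rec2: _ => [|i u v _ IH]; first by rewrite normc0.
exact: le_trans (le_normcD _ _) (lerD _ IH).
Qed.

Lemma Re_le_normc z : `|complex.Re z| <= normc z.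
Proof.
case: z => x y /=; rewrite -sqrtr_sqr ler_sqrt ?addr_ge0 ?sqr_ge0//.
by rewrite lerDl sqr_ge0.
Qed.

Lemma Im_le_normc z : `|complex.Im z| <= normc z.
Proof.
case: z => x y /=; rewrite -sqrtr_sqr ler_sqrt ?addr_ge0 ?sqr_ge0//.
by rewrite lerDr sqr_ge0.
Qed.

Lemma normc_le_ReIm z : normc z <= `|complex.Re z| + `|complex.Im z|.
Proof.
case: z => x y /=; rewrite -[leRHS]ger0_norm ?addr_ge0// -sqrtr_sqr.
rewrite ler_sqrt ?sqr_ge0// sqrrD !real_normK ?num_real// -addrA lerD2l.
by rewrite lerDr mulrn_wge0// mulr_ge0.
Qed.

Lemma ReD z w : complex.Re (z + w) = complex.Re z + complex.Re w.
Proof. by case: z; case: w. Qed.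
Lemma ImD z w : complex.Im (z + w) = complex.Im z + complex.Im w.
Proof. by case: z; case: w. Qed.
Lemma ReN z : complex.Re (- z) = - complex.Re z.
Proof. by case: z. Qed.
Lemma ImN z : complex.Im (- z) = - complex.Im z.
Proof. by case: z. Qed.
Lemma Re_realM x z : complex.Re (x%:C * z) = x * complex.Re z.
Proof. by case: z => a b /=; rewrite mul0r subr0. Qed.
Lemma expC0 : expC (0 : R[i]) = 1.
Proof. by rewrite /expC /= expR0 cos0 sin0 mul1r. Qed.

Lemma expCD z w : expC (z + w) = expC z * expC w.
Proof.
case: z w => a b [c d]; rewrite /expC /= expRD cosD sinD.
by congr (_ +i* _); ring.
Qed.

Lemma expCMn z n : expC (n%:R * z) = expC z ^+ n.
Proof.
elim: n => [|n IH]; first by rewrite mul0r expC0 expr0.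
by rewrite -natr1 mulrDl mul1r expCD IH exprSr.
Qed.

Lemma normc_expC z : normc (expC z) = expR (complex.Re z).
Proof.
rewrite /expC normcM normc_real ger0_norm ?expR_ge0// /normc /=.
by rewrite cos2Dsin2 sqrtr1 mulr1.
Qed.


Lemma MVT_norm (f df : R -> R) (M : R) x :
    (forall y, is_derive y 1 f (df y)) ->
    (forall y, `|y| <= `|x| -> `|df y| <= M) ->
  `|f x - f 0| <= M * `|x|.
Proof.
move=> fdf dfM; have cf : continuous f.
  by move=> y; apply/differentiable_continuous/derivable1_diffP; case: (fdf y).
have cx a b : {within `[a, b], continuous f} by exact: continuous_subspaceT.
have fdf' a b y : y \in `]a, b[ -> is_derive y 1 f (df y) by move=> _; exact: fdf.
have [x0|/ltW x0] := leP 0 x.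
  have [c /[!in_itv]/= /andP[c0 cx'] ->] := MVT_segment x0 (fdf' 0 x) (cx 0 x).
  rewrite subr0 normrM ler_wpM2r// dfM//.
  by rewrite !ger0_norm.
have [c /[!in_itv]/= /andP[cx' c0]] := MVT_segment x0 (fdf' x 0) (cx x 0).
rewrite distrC => ->.
rewrite sub0r normrM normrN ler_wpM2r// dfM//.
by rewrite !ler0_norm ?lerN2.
Qed.

Lemma expR_sub1 x : `|expR x - 1| <= `|x| * expR `|x|.
Proof.
rewrite mulrC -[in leLHS](@expR0 R); apply: (MVT_norm (df := expR)) => y yx.
by rewrite ger0_norm ?expR_ge0// ler_expR (le_trans (ler_norm _)).
Qed.

Lemma sin_le_norm x : `|sin x| <= `|x|.
Proof.
have := @MVT_norm sin cos 1 x; rewrite mul1r sin0 subr0; apply=> y yx.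
exact: cos_max.
Qed.

Lemma cos_sub1 x : `|cos x - 1| <= `|x| ^+ 2.
Proof.
rewrite expr2 -[in leLHS](@cos0 R).
apply: (MVT_norm (df := fun y => - sin y)) => y yx.
by rewrite normrN (le_trans (sin_le_norm _)).
Qed.

Lemma expR_taylor1 x : `|expR x - 1 - x| <= `|x| ^+ 2 * expR `|x|.
Proof.
have := @MVT_norm (fun y => expR y - y) (fun y => expR y - 1)
  (`|x| * expR `|x|) x.
rewrite expR0 subr0 addrAC expr2 mulrAC; apply=> y yx.
apply: le_trans (expR_sub1 _) _.
by rewrite ler_pM ?expR_ge0// ler_expR.
Qed.

Lemma sin_taylor1 x : `|sin x - x| <= `|x| ^+ 2 * `|x|.
Proof.
have := @MVT_norm (fun y => sin y - y) (fun y => cos y - 1) (`|x| ^+ 2) x.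
rewrite sin0 !subr0; apply=> y yx.
by apply: le_trans (cos_sub1 _) _; rewrite lerXn2r ?nnegrE.
Qed.

Lemma expC_taylor1 z :
  normc (expC z - 1 - z) <= 6 * normc z ^+ 2 * expR (normc z).
Proof.
apply: le_trans (normc_le_ReIm _) _.
have := Re_le_normc z; have := Im_le_normc z.
case: z => x y; set r := normc _ => /= yr xr.
have r0 : 0 <= r by exact: normc_ge0.
have er : 1 <= expR r by rewrite -expR0 ler_expR.
have ex : expR x <= expR r by rewrite ler_expR (le_trans (ler_norm _)).
have ex' : expR `|x| <= expR r by rewrite ler_expR.
rewrite !mul0r subr0 addr0 oppr0 addr0.
have xx : `|x| ^+ 2 * expR `|x| <= r ^+ 2 * expR r.
  by rewrite ler_pM ?expR_ge0 ?sqr_ge0// lerXn2r ?nnegrE.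
have c1 : `|cos y - 1| <= r ^+ 2.
  by apply: le_trans (cos_sub1 _) _; rewrite lerXn2r ?nnegrE.
have h1 : `|expR x * cos y - 1 - x| <= 2 * r ^+ 2 * expR r.
  rewrite (_ : _ - x = (expR x - 1 - x) + expR x * (cos y - 1)); last by ring.
  apply: le_trans (ler_normD _ _) _; rewrite normrM (ger0_norm (expR_ge0 _)).
  rewrite -mulrA mulr2n mulrDl mul1r lerD ?(le_trans (expR_taylor1 _))//.
  by rewrite mulrC ler_pM ?expR_ge0.
have h2 : `|expR x * sin y - y| <= 4 * r ^+ 2 * expR r.
  rewrite (_ : _ - y = (expR x - 1) * sin y + (sin y - y)); last by ring.
  apply: le_trans (ler_normD _ _) _; rewrite normrM.
  have -> : 4 * r ^+ 2 * expR r = r ^+ 2 * expR r + 3 * r ^+ 2 * expR r by ring.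
  apply: lerD.
    rewrite expr2 mulrAC; apply: ler_pM => //.
      by apply: le_trans (expR_sub1 _) _; rewrite ler_pM ?expR_ge0.
    exact: le_trans (sin_le_norm _) _.
  have [r1|r1] := leP r 1.
    apply: le_trans (sin_taylor1 _) _.
    have -> : 3 * r ^+ 2 * expR r = r ^+ 2 * (3 * expR r) by ring.
    rewrite ler_pM// ?lerXn2r ?nnegrE//; lra.
  apply: le_trans (ler_normB _ _) _.
  have rr : r <= r ^+ 2 by rewrite expr2 ler_peMl// ltW.
  have := sin_le_norm y.
  have : r ^+ 2 <= r ^+ 2 * expR r by rewrite ler_peMr// sqr_ge0.
  by rewrite -mulrA; set u := r ^+ 2 * _; lra.
by rewrite [X in _ <= X](_ : _ = 2 * r ^+ 2 * expR r + 4 * r ^+ 2 * expR r) ?lerD//; ring.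
Qed.

Lemma expC_sub1 z : normc (expC z - 1) <= 7 * normc z * expR (2 * normc z).
Proof.
rewrite (_ : expC z - 1 = (expC z - 1 - z) + z); last by ring.
apply: le_trans (le_normcD _ _) _.
have := expC_taylor1 z; have := normc_ge0 z; set r := normc z => r0 h.
have er : r <= expR r by have := expR_ge1Dx r; lra.
have e1 : 1 <= expR r by rewrite -expR0 ler_expR.
have e2 : expR (2 * r) = expR r * expR r by rewrite -expRD; congr expR; ring.
apply: le_trans (lerD h (lexx r)) _; rewrite e2.
have -> : 7 * r * (expR r * expR r) =
  6 * r ^+ 2 * expR r + (6 * r * expR r * (expR r - r) + r * expR r ^+ 2) by ring.
rewrite lerD2l -[leLHS]add0r lerD//.
  by rewrite !mulr_ge0 ?expR_ge0// subr_ge0.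
by rewrite ler_peMr// exprn_ege1.
Qed.

Lemma normc_subX z w (r : R) n : normc z <= r -> normc w <= r ->
  normc (z ^+ n - w ^+ n) <= n%:R * normc (z - w) * r ^+ n.-1.
Proof.
move=> zr wr; have r0 := le_trans (normc_ge0 z) zr.
rewrite subrXX normcM (mulrC n%:R) -mulrA ler_wpM2l ?normc_ge0//.
apply: le_trans (normc_sum _ _ _) _.
rewrite (_ : n%:R = \sum_(i < n) (1 : R)); last by rewrite sumr_const card_ord.
rewrite mulr_suml ler_sum// => i _; rewrite mul1r normcM !normcX.
rewrite (_ : r ^+ n.-1 = r ^+ (n.-1 - i) * r ^+ i).
  2: by rewrite -exprD subnK//; have := ltn_ord i; lia.
by rewrite ler_pM ?exprn_ge0 ?normc_ge0// lerXn2r ?nnegrE ?normc_ge0.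
Qed.

(** Euler's limit for the exponential, with an explicit rate that is uniform on
discs; it is what makes exponentials of uniform limits of Dirichlet polynomials
again such limits. *)
Lemma expC_euler z (r : R) n : normc z <= r ->
  normc (expC z - (1 + z / n.+1%:R) ^+ n.+1)
    <= 6 * r ^+ 2 * expR (2 * r) / n.+1%:R.
Proof.
move=> zr; have r0 := le_trans (normc_ge0 z) zr.
set m := n.+1; set w := z / m%:R.
have m0 : (0 : R) < m%:R by rewrite ltr0n.
have mC0 : (m%:R : R[i]) != 0 by rewrite pnatr_eq0.
have zw : z = m%:R * w by rewrite /w mulrC divfK.
have wr : normc w <= r / m%:R.
  by rewrite /w normcM normcV normc_nat ler_wpM2r// invr_ge0 ltW.
rewrite {1}zw expCMn.
have h1 : normc (expC w) <= expR (r / m%:R).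
  rewrite normc_expC ler_expR; apply: le_trans (ler_norm _) _.
  exact: le_trans (Re_le_normc _) _.
have h2 : normc (1 + w) <= expR (r / m%:R).
  apply: le_trans (le_normcD _ _) _; rewrite normc1.
  by apply: le_trans (expR_ge1Dx _); rewrite lerD2l.
apply: le_trans (normc_subX _ h1 h2) _.
have h3 : normc (expC w - (1 + w)) <= 6 * (r / m%:R) ^+ 2 * expR (r / m%:R).
  rewrite opprD addrA; apply: le_trans (expC_taylor1 _) _.
  rewrite ler_pM ?expR_ge0 ?mulr_ge0 ?exprn_ge0 ?normc_ge0 ?ler_expR//.
  by rewrite ler_wpM2l// lerXn2r ?nnegrE ?normc_ge0 ?divr_ge0 ?ler0n.
have e1 : expR (r / m%:R) <= expR r.
  by rewrite ler_expR ler_pdivrMr// ler_peMr// ler1n.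
have e2 : expR (r / m%:R) ^+ m.-1 <= expR r.
  rewrite -expRM_natl ler_expR mulrA ler_pdivrMr// mulrC ler_wpM2l//.
  by rewrite ler_nat leq_pred.
have -> : 6 * r ^+ 2 * expR (2 * r) / m%:R =
   m%:R * (6 * (r / m%:R) ^+ 2 * expR r) * expR r.
  rewrite (_ : 2 * r = r + r) ?expRD; last by ring.
  by field; rewrite lt0r_neq0.
rewrite ler_pM ?mulr_ge0 ?normc_ge0 ?exprn_ge0 ?expR_ge0 ?ler0n//.
rewrite ler_wpM2l ?ler0n//; apply: le_trans h3 _.
by rewrite ler_wpM2l// mulr_ge0 ?exprn_ge0// divr_ge0 ?ler0n.
Qed.

End ComplexExponential.

(** * Dirichlet polynomials and Bohr's class *)

Section DirichletPolynomials.
Variable R : realType.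
Implicit Types (x y : R) (s z w : R[i]) (n m : nat) (F G : R[i] -> R[i]).

Lemma npow1 s : npow 1 s = 1.
Proof. by rewrite /npow ln1 mulr0 oppr0 expC0. Qed.

Lemma npow0 n : npow n (0 : R[i]) = 1.
Proof. by rewrite /npow mul0r oppr0 expC0. Qed.

Lemma npowD n s z : npow n (s + z) = npow n s * npow n z.
Proof. by rewrite /npow mulrDl opprD expCD. Qed.

Lemma npowM n m s : (0 < n)%N -> (0 < m)%N ->
  npow (n * m) s = npow n s * npow m s.
Proof.
move=> n0 m0; rewrite /npow natrM lnM ?posrE ?ltr0n//.
by rewrite rmorphD mulrDr opprD expCD.
Qed.

Lemma npowX n c s : (0 < n)%N -> npow (n ^ c) s = npow n (c%:R * s).
Proof.
move=> n0; elim: c => [|c IH]; first by rewrite expn0 npow1 mul0r npow0.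
by rewrite expnS npowM ?expn_gt0 ?n0// IH -npowD -[c.+1]addn1 natrD mulrDl mul1r addrC.
Qed.

Lemma normc_npow n s : normc (npow n s) = expR (- (complex.Re s * ln n%:R)).
Proof. by rewrite normc_expC ReN mulrC Re_realM mulrC. Qed.

Lemma ln_nat_ge0 n : 0 <= ln n%:R :> R.
Proof.
by case: n => [|n]; [rewrite ln0 | rewrite ln_ge0// ler1n].
Qed.

Lemma normc_npow_le1 n s : 0 <= complex.Re s -> normc (npow n s) <= 1.
Proof.
move=> s0; rewrite normc_npow -[leRHS]expR0 ler_expR oppr_le0.
by rewrite mulr_ge0 ?ln_nat_ge0.
Qed.

Lemma normc_npow_leX n (X : nat) s : (0 < n)%N -> X%:R <= complex.Re s ->
  normc (npow n s) <= (n%:R ^+ X)^-1.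
Proof.
move=> n0 Xs; have n0' : (0 : R) < n%:R by rewrite ltr0n.
rewrite normc_npow expRN lef_pV2 ?posrE ?expR_gt0 ?exprn_gt0//.
rewrite -[n%:R in leLHS]lnK// -expRM_natl ler_expR.
by rewrite ler_wpM2r ?ln_nat_ge0.
Qed.

(** A Dirichlet polynomial, as the list of its terms: the pair [(c, n)] stands
for the term [c (n+1)^(-s)].  Repeated frequencies are allowed, so that sums
and products of polynomials need no normal form. *)
Definition dpoly := seq (R[i] * nat).

Definition dp_eval (l : dpoly) s := \sum_(t <- l) t.1 * npow t.2.+1 s.

Definition dp_coef (l : dpoly) n := \sum_(t <- l | t.2 == n) t.1.

Definition dp_scale c (l : dpoly) : dpoly := [seq (c * t.1, t.2) | t <- l].

(** Multiplication by [d^(-s)]; the predecessor undoes the shift of indices. *)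
Definition dp_shift d (l : dpoly) : dpoly :=
  [seq (t.1, (d * t.2.+1).-1) | t <- l].

Definition dp_mul (l r : dpoly) : dpoly :=
  flatten [seq dp_scale t.1 (dp_shift t.2.+1 r) | t <- l].

(** Substitution of [c s] for [s], as [n^(-c s) = (n^c)^(-s)]. *)
Definition dp_dilate c (l : dpoly) : dpoly :=
  [seq (t.1, (t.2.+1 ^ c).-1) | t <- l].

Lemma dp_eval_cat l r s : dp_eval (l ++ r) s = dp_eval l s + dp_eval r s.
Proof. by rewrite /dp_eval big_cat. Qed.

Lemma dp_eval_scale c l s : dp_eval (dp_scale c l) s = c * dp_eval l s.
Proof.
by rewrite /dp_eval big_map mulr_sumr; apply: eq_bigr => t _; rewrite mulrA.
Qed.

Lemma dp_eval_shift d l s : (0 < d)%N ->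
  dp_eval (dp_shift d l) s = npow d s * dp_eval l s.
Proof.
move=> d0; rewrite /dp_eval big_map mulr_sumr; apply: eq_bigr => t _ /=.
by rewrite prednK ?muln_gt0 ?d0// npowM// mulrCA.
Qed.

Lemma dp_eval_mul l r s : dp_eval (dp_mul l r) s = dp_eval l s * dp_eval r s.
Proof.
elim: l => [|t l IH]; first by rewrite /dp_eval !big_nil mul0r.
rewrite /dp_mul /= dp_eval_cat dp_eval_scale dp_eval_shift//.
by rewrite -/(dp_mul l r) IH {4}/dp_eval big_cons -/(dp_eval l s) mulrDl mulrA.
Qed.

Lemma dp_eval_dilate c l s : dp_eval (dp_dilate c l) s = dp_eval l (c%:R * s).
Proof.
rewrite /dp_eval big_map; apply: eq_bigr => t _ /=.
by rewrite prednK ?expn_gt0// npowX.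
Qed.

Lemma dp_coef_shift d l n : (0 < d)%N ->
  dp_coef (dp_shift d l) (d * n.+1).-1 = dp_coef l n.
Proof.
move=> d0; rewrite /dp_coef big_map; apply: eq_bigl => t /=.
rewrite -eqSS !prednK ?muln_gt0 ?d0// eqn_pmul2l//.
Qed.

Lemma dp_coef_shift0 d l n : (0 < d)%N -> ~~ (d %| n.+1)%N ->
  dp_coef (dp_shift d l) n = 0.
Proof.
move=> d0 dn; rewrite /dp_coef big_map big_pred0// => t /=; apply/negbTE.
apply: contra dn => /eqP <-; rewrite prednK ?muln_gt0 ?d0//.
exact: dvdn_mulr.
Qed.

Lemma dp_coef_dilate c l n : (0 < c)%N ->
  dp_coef (dp_dilate c l) (n.+1 ^ c).-1 = dp_coef l n.
Proof.
move=> c0; rewrite /dp_coef big_map; apply: eq_bigl => t /=.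
by rewrite -eqSS !prednK ?expn_gt0// eqn_exp2r.
Qed.

Lemma dp_coef_dilate0 c l n : (forall k, (k.+1 ^ c)%N <> n.+1) ->
  dp_coef (dp_dilate c l) n = 0.
Proof.
move=> h; rewrite /dp_coef big_map big_pred0// => t /=; apply/negbTE/eqP => tn.
by apply: (h t.2); rewrite -tn prednK ?expn_gt0.
Qed.

Lemma dp_eval_bounded l s : 0 <= complex.Re s ->
  normc (dp_eval l s) <= \sum_(t <- l) normc t.1.
Proof.
move=> s0; apply: le_trans (normc_sum _ _ _) (ler_sum _ _) => t _.
by rewrite normcM ler_piMr ?normc_ge0 ?normc_npow_le1.
Qed.

(** Bohr's class: uniform limits of Dirichlet polynomials on the half-plane
[Re s > x].  Membership is what later allows one to speak of the Dirichlet
coefficients of functions, such as iterates and inverse branches of symbols,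
that are not given as series. *)
Definition bohr x F := forall e : R, 0 < e -> exists l : dpoly,
  forall s, x < complex.Re s -> normc (F s - dp_eval l s) <= e.

Lemma bohr_ext x F G : (forall s, x < complex.Re s -> F s = G s) ->
  bohr x F -> bohr x G.
Proof.
by move=> FG bF e /bF[l hl]; exists l => s xs; rewrite -FG// hl.
Qed.

Lemma bohr_lim x F : (forall e, 0 < e -> exists2 G, bohr x G &
    forall s, x < complex.Re s -> normc (F s - G s) <= e) -> bohr x F.
Proof.
move=> h e e0; have e20 : 0 < e / 2 by rewrite divr_gt0.
have [G bG FG] := h _ e20; have [l hl] := bG _ e20.
exists l => s xs; apply: le_trans (normc_distD (G s) _ _) _.
by rewrite [e]splitr lerD ?FG ?hl.
Qed.

Lemma bohr_dp x l : bohr x (dp_eval l).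
Proof. by move=> e e0; exists l => s _; rewrite subrr normc0 ltW. Qed.

Lemma bohr_npow x n : (0 < n)%N -> bohr x (fun s => npow n s).
Proof.
case: n => // n _; apply: bohr_ext (bohr_dp x [:: (1, n)]) => s _.
by rewrite /dp_eval big_seq1 mul1r.
Qed.

Lemma bohr_cst x c : bohr x (fun=> c).
Proof.
apply: bohr_ext (bohr_dp x [:: (c, 0)]) => s _.
by rewrite /dp_eval big_seq1 npow1 mulr1.
Qed.

Lemma bohrD x F G : bohr x F -> bohr x G -> bohr x (fun s => F s + G s).
Proof.
move=> bF bG e e0; have e20 : 0 < e / 2 by rewrite divr_gt0.
have [l hl] := bF _ e20; have [r hr] := bG _ e20.
exists (l ++ r) => s xs; rewrite dp_eval_cat opprD addrACA.
by apply: le_trans (le_normcD _ _) _; rewrite [e]splitr lerD ?hl ?hr.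
Qed.

Lemma bohr_bounded x F : 0 <= x -> bohr x F -> exists2 B, 0 <= B &
  forall s, x < complex.Re s -> normc (F s) <= B.
Proof.
move=> x0 bF; have [l hl] := bF 1 ltr01.
exists (1 + \sum_(t <- l) normc t.1) => [|s xs].
  by rewrite addr_ge0// sumr_ge0// => t _; exact: normc_ge0.
rewrite -[F s](subrK (dp_eval l s)); apply: le_trans (le_normcD _ _) _.
by rewrite lerD ?hl// dp_eval_bounded// (le_trans x0)// ltW.
Qed.

Lemma mul_div_addr1_le (a b : R) : 0 <= a -> 0 <= b -> a * (b / (a + 1)) <= b.
Proof.
move=> a0 b0; have a1 : 0 < a + 1 by rewrite ltr_wpDl.
by rewrite mulrCA ler_piMr// ler_pdivrMr// mul1r lerDl.
Qed.

Lemma bohrM x F G : 0 <= x -> bohr x F -> bohr x G ->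
  bohr x (fun s => F s * G s).
Proof.
move=> x0 bF bG e e0.
have [B B0 FB] := bohr_bounded x0 bF.
have e20 : 0 < e / 2 by rewrite divr_gt0.
have [r hr] := bG (e / 2 / (B + 1)) (divr_gt0 e20 (ltr_wpDl B0 ltr01)).
set D := \sum_(t <- r) normc t.1.
have D0 : 0 <= D by rewrite sumr_ge0// => t _; exact: normc_ge0.
have [l hl] := bF (e / 2 / (D + 1)) (divr_gt0 e20 (ltr_wpDl D0 ltr01)).
exists (dp_mul l r) => s xs; rewrite dp_eval_mul.
rewrite (_ : _ - _ = F s * (G s - dp_eval r s)
    + dp_eval r s * (F s - dp_eval l s)); last by ring.
have s0 : 0 <= complex.Re s by rewrite (le_trans x0)// ltW.
apply: le_trans (le_normcD _ _) _; rewrite !normcM [e]splitr lerD//.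
  apply: le_trans (mul_div_addr1_le B0 (ltW e20)).
  by rewrite ler_pM ?normc_ge0 ?FB ?hr.
apply: le_trans (mul_div_addr1_le D0 (ltW e20)).
by rewrite ler_pM ?normc_ge0 ?hl// dp_eval_bounded.
Qed.

Lemma bohrZ x c F : bohr x F -> bohr x (fun s => c * F s).
Proof.
move=> bF e e0; have c1 : 0 < normc c + 1 by rewrite ltr_wpDl ?normc_ge0.
have [l hl] := bF (e / (normc c + 1)) (divr_gt0 e0 c1).
exists (dp_scale c l) => s xs; rewrite dp_eval_scale -mulrBr normcM.
apply: le_trans (ler_wpM2l (normc_ge0 _) (hl _ xs)) _.
exact: mul_div_addr1_le (normc_ge0 _) (ltW e0).
Qed.

Lemma bohrX x F n : 0 <= x -> bohr x F -> bohr x (fun s => F s ^+ n).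
Proof.
move=> x0 bF; elim: n => [|n IH].
  by apply: bohr_ext (bohr_cst x 1) => s _; rewrite expr0.
by apply: bohr_ext (bohrM x0 bF IH) => s _; rewrite exprS.
Qed.

Lemma bohr_sum x (I : Type) (r : seq I) (F : I -> R[i] -> R[i]) :
  (forall i, bohr x (F i)) -> bohr x (fun s => \sum_(i <- r) F i s).
Proof.
move=> bF; elim: r => [|i r IH].
  by apply: bohr_ext (bohr_cst x 0) => s _; rewrite big_nil.
by apply: bohr_ext (bohrD (bF i) IH) => s _; rewrite big_cons.
Qed.

Lemma bohr_expC x F : 0 <= x -> bohr x F -> bohr x (fun s => expC (F s)).
Proof.
move=> x0 bF; have [B B0 FB] := bohr_bounded x0 bF.
apply: bohr_lim => e e0.
set K := 6 * B ^+ 2 * expR (2 * B).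
have K0 : 0 <= K by rewrite !mulr_ge0 ?expR_ge0.
pose n := Num.truncn (K / e).
have Kn : K / e < n.+1%:R by rewrite truncnS_gt.
exists (fun s => (1 + F s / n.+1%:R) ^+ n.+1) => [|s xs].
  apply: bohrX => //; apply: bohrD; first exact: bohr_cst.
  by apply: bohr_ext (bohrZ (n.+1%:R^-1) bF) => s _; rewrite mulrC.
apply: le_trans (expC_euler _ (FB _ xs)) _.
by rewrite -/K ler_pdivrMr ?ltr0n// -ler_pdivrMl// mulrC ltW.
Qed.

Lemma bohr_npow_comp x n F : 0 <= x -> bohr x F -> bohr x (fun s => npow n (F s)).
Proof.
move=> x0 bF; apply: bohr_expC => //.
by apply: bohr_ext (bohrZ (- (ln n%:R)%:C) bF) => s _; rewrite mulNr mulrC.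
Qed.

(** Composition with a symbol [c s + v(s)]: on a Dirichlet polynomial it acts by
[n^(-s) |-> n^(-c s) exp (- v(s) log n)], and uniform limits are preserved. *)
Lemma bohr_comp x y c F v : 0 <= y -> bohr x F -> bohr y v ->
    (forall s, y < complex.Re s -> x < complex.Re (c%:R * s + v s)) ->
  bohr y (fun s => F (c%:R * s + v s)).
Proof.
move=> y0 bF bv xy; apply: bohr_lim => e e0; have [l hl] := bF _ e0.
exists (fun s => dp_eval l (c%:R * s + v s)) => [|s ys]; last exact/hl/xy.
apply: bohr_sum => t; apply: bohrZ.
have b1 := bohr_npow y (n := (t.2.+1 ^ c)%N); rewrite expn_gt0 in b1.
apply: bohr_ext (bohrM y0 (b1 isT) (bohr_npow_comp t.2.+1 y0 bv)) => s _.
by rewrite npowX// npowD.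
Qed.

End DirichletPolynomials.

(** * Mean values on vertical lines *)

Section Coefficients.
Variable R : realType.
Implicit Types (x y e B : R) (s z c : R[i]) (n m M N : nat) (u v : nat -> R[i]).
Implicit Types (F G : R[i] -> R[i]).

(** Quantifying over real [e] keeps all estimates in the totally ordered field
[R]. *)
Definition tends u c := forall e : R, 0 < e -> exists N : nat, forall M : nat,
  (N <= M)%N -> normc (u M - c) <= e.

Lemma tends_cst c : tends (fun=> c) c.
Proof. by move=> e e0; exists 0 => M _; rewrite subrr normc0 ltW. Qed.

Lemma tends_ext u v c : u =1 v -> tends u c -> tends v c.
Proof. by move=> uv uc e /uc[N hN]; exists N => M /hN; rewrite uv. Qed.

Lemma tendsD u v c d : tends u c -> tends v d -> tends (fun M => u M + v M) (c + d).
Proof.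
move=> uc vd e e0; have e20 : 0 < e / 2 by rewrite divr_gt0.
have [N hN] := uc _ e20; have [N' hN'] := vd _ e20.
exists (maxn N N') => M; rewrite geq_max => /andP[NM NM'].
rewrite opprD addrACA; apply: le_trans (le_normcD _ _) _.
by rewrite [e]splitr lerD ?hN ?hN'.
Qed.

Lemma tendsZ u c d : tends u c -> tends (fun M => d * u M) (d * c).
Proof.
move=> uc e e0.
have [N hN] := uc (e / (normc d + 1)) (divr_gt0 e0 (ltr_wpDl (normc_ge0 d) ltr01)).
exists N => M NM; rewrite -mulrBr normcM.
apply: le_trans (ler_wpM2l (normc_ge0 _) (hN _ NM)) _.
exact: mul_div_addr1_le (normc_ge0 _) (ltW e0).
Qed.

Lemma tends_sum (I : Type) (r : seq I) (u : I -> nat -> R[i]) (c : I -> R[i]) :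
  (forall i, tends (u i) (c i)) ->
  tends (fun M => \sum_(i <- r) u i M) (\sum_(i <- r) c i).
Proof.
move=> uc; elim: r => [|i r IH].
  by rewrite big_nil; apply: tends_ext (tends_cst 0) => M; rewrite big_nil.
rewrite big_cons; apply: tends_ext (tendsD (uc i) IH) => M.
by rewrite big_cons.
Qed.

Lemma tends_normc_le u c B : (forall M, normc (u M) <= B) -> tends u c ->
  normc c <= B.
Proof.
move=> uB uc; apply/ler_addgt0Pr => e /uc[N hN].
rewrite -[c](subrK (u N)) addrC; apply: le_trans (le_normcD _ _) _.
by rewrite lerD// normc_distC hN.
Qed.

Lemma tends_Re_le u c B : (forall M, complex.Re (u M) <= B) -> tends u c ->
  complex.Re c <= B.
Proof.
move=> uB uc; apply/ler_addgt0Pr => e /uc[N hN].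
rewrite -[c](subrK (u N)) addrC ReD lerD//.
apply: le_trans (ler_norm _) _; apply: le_trans (Re_le_normc _) _.
by rewrite normc_distC hN.
Qed.

Lemma tends_uniq u c d : tends u c -> tends u d -> c = d.
Proof.
move=> uc ud; apply/eqP; rewrite -subr_eq0; apply/eqP/eq0_normc/eqP.
rewrite eq_le normc_ge0 andbT.
apply: (@tends_normc_le (fun=> 0)) => [M|]; first by rewrite normc0.
rewrite -mulN1r; apply: tends_ext (tendsD uc (tendsZ (-1) ud)) => M.
by rewrite mulN1r subrr.
Qed.

Lemma tends_complete u :
  (forall e, 0 < e -> exists N, forall n m, (N <= n)%N -> (N <= m)%N ->
     normc (u n - u m) <= e) -> exists c, tends u c.
Proof.
move=> cu.
have real_part (f : R[i] -> R) : (forall z w, `|f z - f w| <= normc (z - w)) ->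
    exists l : R, forall e, 0 < e -> exists N, forall n, (N <= n)%N ->
      `|f (u n) - l| <= e.
  move=> f1; have cf : cauchy ((fun n => f (u n)) @ \oo).
    apply: cauchy_exP => e e0; have [N hN] := cu (e / 2) (divr_gt0 e0 (ltr0n _ 2)).
    exists (f (u N)); exists N => // n /= Nn.
    rewrite -ball_normE /=; apply: le_lt_trans (f1 _ _) _.
    apply: le_lt_trans (hN _ _ _ Nn) _ => //.
    by rewrite ltr_pdivrMr// ltr_pMr// ltr1n.
  have /cvg_ex[l hl] : cvg ((fun n => f (u n)) @ \oo) by exact: cauchy_cvg.
  exists l => e e0.
  have /cvgrPdist_le /(_ _ e0)[N _ hN] := hl.
  by exists N => n Nn; rewrite distrC; exact: hN.
have [z w|a ha] := real_part (@complex.Re R).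
  by rewrite -ReN -ReD Re_le_normc.
have [z w|b hb] := real_part (@complex.Im R).
  by rewrite -ImN -ImD Im_le_normc.
exists (a +i* b) => e e0; have e20 : 0 < e / 2 by rewrite divr_gt0.
have [N hN] := ha _ e20; have [N' hN'] := hb _ e20.
exists (maxn N N') => M; rewrite geq_max => /andP[NM NM'].
apply: le_trans (normc_le_ReIm _) _; rewrite ReD ReN ImD ImN /=.
by rewrite [e]splitr lerD ?hN ?hN'.
Qed.


(** Sampling points of the vertical line [Re s = x], for [j < (M+1)^2]: as [M]
grows, the mesh [1/(M+1)] tends to 0 and the segment covered becomes infinitely
long, so that averages over them are mean values without integration. *)
Definition sample x M (j : nat) : R[i] := x +i* (j%:R / M.+1%:R).

Definition line_avg x M F : R[i] :=
  (M.+1 ^ 2)%:R^-1 * \sum_(j < M.+1 ^ 2) F (sample x M j).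

Lemma eq_line_avg x M F G : (forall s, complex.Re s = x -> F s = G s) ->
  line_avg x M F = line_avg x M G.
Proof. by move=> FG; congr (_ * _); apply: eq_bigr => j _; exact: FG. Qed.

Lemma line_avgD x M F G :
  line_avg x M (fun s => F s + G s) = line_avg x M F + line_avg x M G.
Proof. by rewrite /line_avg big_split mulrDr. Qed.

Lemma line_avgZ x M c F : line_avg x M (fun s => c * F s) = c * line_avg x M F.
Proof. by rewrite /line_avg -mulr_sumr mulrCA. Qed.

Lemma line_avg_sum x M (I : Type) (r : seq I) (F : I -> R[i] -> R[i]) :
  line_avg x M (fun s => \sum_(i <- r) F i s) = \sum_(i <- r) line_avg x M (F i).
Proof. by rewrite /line_avg exchange_big mulr_sumr. Qed.

Lemma line_avg_cst x M c : line_avg x M (fun=> c) = c.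
Proof.
rewrite /line_avg sumr_const card_ord -[c *+ _]mulr_natl mulrA mulVf ?mul1r//.
Qed.

Lemma normc_line_avg x M F B : (forall s, complex.Re s = x -> normc (F s) <= B) ->
  normc (line_avg x M F) <= B.
Proof.
move=> FB; have M0 : (0 : R) < (M.+1 ^ 2)%:R by rewrite ltr0n expn_gt0.
rewrite normcM normcV normc_nat mulrC ler_pdivrMr//.
apply: le_trans (normc_sum _ _ _) _.
rewrite mulr_natr -[in leRHS](card_ord (M.+1 ^ 2)) -sumr_const.
by rewrite ler_sum// => j _; rewrite FB.
Qed.

Lemma Re_line_avg_le x M F B :
  (forall s, complex.Re s = x -> complex.Re (F s) <= B) ->
  complex.Re (line_avg x M F) <= B.
Proof.
move=> FB; have M0 : (0 : R) < (M.+1 ^ 2)%:R by rewrite ltr0n expn_gt0.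
have -> : line_avg x M F = ((M.+1 ^ 2)%:R^-1)%:C * \sum_(j < M.+1 ^ 2) F (sample x M j).
  by rewrite /line_avg fmorphV rmorph_nat.
rewrite Re_realM mulrC ler_pdivrMr//.
have Re_sum : complex.Re (\sum_(j < M.+1 ^ 2) F (sample x M j))
    = \sum_(j < M.+1 ^ 2) complex.Re (F (sample x M j)).
  by apply: (big_morph _ (@ReD R)).
rewrite Re_sum mulr_natr -[in leRHS](card_ord (M.+1 ^ 2)) -sumr_const.
by rewrite ler_sum// => j _; rewrite FB.
Qed.

(** A geometric sum of [(M+1)^2] terms whose ratio is at distance of order
[1/M] from 1 is of order [M]; hence the mean of a nonconstant character is 0. *)
Lemma line_avg_expC x (a : R) : a != 0 ->
  tends (fun M => line_avg x M (fun s => expC (a%:C * s))) 0.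
Proof.
move=> a0; have na0 : 0 < `|a| by rewrite normr_gt0.
set K := expR (x * a).
have K0 : 0 < K by exact: expR_gt0.
(* the first-order expansion of the exponential keeps the ratio away from 1 *)
have gap M (M' := M.+1%:R : R) (q := expC (0 +i* (a / M'))) :
    12 * `|a| * expR `|a| <= M' -> `|a| / (2 * M') <= normc (q - 1).
  move=> hM; have M0 : 0 < M' by rewrite ltr0n.
  have nw : normc (0 +i* (a / M')) = `|a| / M'.
    by rewrite /= expr0n add0r sqrtr_sqr normrM normfV (ger0_norm (ltW M0)).
  have := expC_taylor1 (0 +i* (a / M')); rewrite nw -/q => h1.
  have h2 : `|a| / M' <= normc (q - 1) + normc (q - 1 - 0 +i* (a / M')).
    rewrite -nw -[X in normc X <= _](subKr (q - 1)).
    exact: normcB.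
  have h3 : 6 * (`|a| / M') ^+ 2 * expR (`|a| / M') <= `|a| / (2 * M').
    have e1 : expR (`|a| / M') <= expR `|a|.
      by rewrite ler_expR ler_pdivrMr// ler_peMr ?ler1n// ltW.
    apply: le_trans (ler_wpM2l _ e1) _; first by rewrite mulr_ge0// sqr_ge0.
    have -> : 6 * (`|a| / M') ^+ 2 * expR `|a| =
      (12 * `|a| * expR `|a|) * (`|a| / (2 * M' ^+ 2)).
      by field; rewrite gt_eqF.
    apply: le_trans (ler_wpM2r _ hM) _.
      by rewrite divr_ge0// mulr_ge0// sqr_ge0.
    by rewrite le_eqVlt; apply/orP; left; apply/eqP; field; rewrite gt_eqF.
  have e2 : `|a| / M' = `|a| / (2 * M') + `|a| / (2 * M').
    by field; rewrite gt_eqF.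
  move: (le_trans h2 (lerD (lexx _) h1)) h3.
  set t := 6 * _ * _; rewrite e2; set b := `|a| / (2 * M'); lra.
move=> e e0; pose N := Num.truncn (12 * `|a| * expR `|a| + 4 * K / `|a| / e).
exists N => M NM; rewrite subr0; set M' := M.+1%:R : R.
have M0 : 0 < M' by rewrite ltr0n.
have hN : 12 * `|a| * expR `|a| + 4 * K / `|a| / e <= M'.
  by apply: le_trans (ltW (truncnS_gt _)) _; rewrite ler_nat ltnS.
have hM1 : 12 * `|a| * expR `|a| <= M'.
  by apply: le_trans hN; rewrite lerDl !divr_ge0 ?mulr_ge0// ltW.
have hM2 : 4 * K / `|a| / e <= M'.
  by apply: le_trans hN; rewrite lerDr !mulr_ge0// ltW// expR_gt0.
set q := expC (0 +i* (a / M')).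
have nq : normc q = 1 by rewrite normc_expC expR0.
have q1 := gap M hM1; rewrite -/M' -/q in q1.
have q1' : 0 < normc (q - 1) by apply: lt_le_trans q1; rewrite divr_gt0// mulr_gt0.
have Fq j : expC (a%:C * sample x M j) = K%:C * q ^+ j.
  rewrite -expCMn /K /sample.
  have -> : a%:C * (x +i* (j%:R / M.+1%:R)) = (x * a)%:C + j%:R * (0 +i* (a / M')).
    rewrite -(rmorph_nat (real_complex R)) /=; apply/eqP; rewrite eq_complex /=.
    by apply/andP; split; apply/eqP; rewrite /M'; ring.
  rewrite expCD; congr (_ * _).
  by rewrite /expC /= cos0 sin0 mulr1.
have sumq : normc (\sum_(j < M.+1 ^ 2) expC (a%:C * sample x M j))
    <= K * (2 / (`|a| / (2 * M'))).
  under eq_bigr do rewrite Fq.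
  rewrite -mulr_sumr normcM normc_real.
  rewrite (ger0_norm (ltW K0)) ler_wpM2l ?(ltW K0)//.
  rewrite ler_pdivlMr ?divr_gt0 ?mulr_gt0//.
  apply: le_trans (_ : normc (q - 1) * normc (\sum_(j < M.+1 ^ 2) q ^+ j) <= _).
    by rewrite mulrC ler_wpM2r ?normc_ge0.
  rewrite -normcM -subrX1; apply: le_trans (normcB _ _) _.
  by rewrite normc1 normcX nq expr1n.
rewrite /line_avg normcM normcV normc_nat natrX -/M'.
apply: le_trans (ler_wpM2l _ sumq) _; first by rewrite invr_ge0 exprn_ge0// ltW.
have -> : (M' ^+ 2)^-1 * (K * (2 / (`|a| / (2 * M')))) = (4 * K / `|a| / e) * (e / M').
  by field; rewrite !gt_eqF.
apply: le_trans (ler_wpM2r _ hM2) _; first by rewrite divr_ge0// ltW.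
by rewrite mulrCA divff ?mulr1// gt_eqF.
Qed.

End Coefficients.

(** * Coefficients of functions in Bohr's class *)

Section BohrCoefficients.
Variable R : realType.
Implicit Types (x y e B : R) (s z c : R[i]) (n m M N : nat).
Implicit Types (F G : R[i] -> R[i]).

(** [c] is the coefficient of [(n+1)^(-s)] in [F], as the mean of
[F(s) (n+1)^s] on the line [Re s = x]. *)
Definition is_coef x F n c :=
  tends (fun M => line_avg x M (fun s => F s * npow n.+1 (- s))) c.

Lemma eq_is_coef x F G n c : (forall s, complex.Re s = x -> F s = G s) ->
  is_coef x F n c -> is_coef x G n c.
Proof.
move=> FG; apply: tends_ext => M; apply: eq_line_avg => s sx.
by rewrite FG.
Qed.

Lemma is_coef_uniq x F n c d : is_coef x F n c -> is_coef x F n d -> c = d.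
Proof. exact: tends_uniq. Qed.

Lemma is_coefD x F G n c d : is_coef x F n c -> is_coef x G n d ->
  is_coef x (fun s => F s + G s) n (c + d).
Proof.
move=> cF cG; apply: tends_ext (tendsD cF cG) => M.
by rewrite -line_avgD; apply: eq_line_avg => s _; rewrite mulrDl.
Qed.

Lemma is_coefZ x F n c k : is_coef x F n c ->
  is_coef x (fun s => k * F s) n (k * c).
Proof.
move=> cF; apply: tends_ext (tendsZ k cF) => M.
by rewrite -line_avgZ; apply: eq_line_avg => s _; rewrite mulrA.
Qed.

Lemma is_coef_sum x (I : Type) (r : seq I) (F : I -> R[i] -> R[i]) n (c : I -> R[i]) :
  (forall i, is_coef x (F i) n (c i)) ->
  is_coef x (fun s => \sum_(i <- r) F i s) n (\sum_(i <- r) c i).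
Proof.
move=> cF; apply: tends_ext (tends_sum r cF) => M.
by rewrite -line_avg_sum; apply: eq_line_avg => s _; rewrite mulr_suml.
Qed.

Lemma is_coef_npow x n m : is_coef x (fun s => npow m.+1 s) n (m == n)%:R.
Proof.
have E s : npow m.+1 s * npow n.+1 (- s) =
    expC ((ln n.+1%:R - ln m.+1%:R)%:C * s).
  by rewrite /npow -expCD; congr expC; rewrite rmorphB /=; ring.
case: eqP => [->|mn].
  apply: tends_ext (tends_cst 1) => M.
  rewrite -(line_avg_cst x M 1); apply: eq_line_avg => s _.
  by rewrite -npowD subrr npow0.
apply: tends_ext (@line_avg_expC R x (ln n.+1%:R - ln m.+1%:R) _) => [M|].
  by apply: eq_line_avg => s _; rewrite E.
rewrite subr_eq0; apply/eqP => /ln_inj; rewrite !posrE !ltr0n => /(_ isT isT)/eqP.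
by rewrite eqr_nat eqSS eq_sym => /eqP.
Qed.

Lemma is_coef_dp x l n : is_coef x (dp_eval l) n (dp_coef l n).
Proof.
rewrite /dp_coef big_mkcond; apply: is_coef_sum => t.
rewrite (_ : (if _ then _ else _) = t.1 * (t.2 == n)%:R).
  by apply: is_coefZ; exact: is_coef_npow.
by case: eqP => _; rewrite ?mulr1 ?mulr0.
Qed.

Lemma is_coef_bound x F n c B : (forall s, complex.Re s = x -> normc (F s) <= B) ->
  is_coef x F n c -> normc c <= B * expR (x * ln n.+1%:R).
Proof.
move=> FB; apply: tends_normc_le => M; apply: normc_line_avg => s sx.
rewrite normcM normc_npow ReN mulNr opprK sx.
by rewrite ler_wpM2r ?expR_ge0// FB.
Qed.

Lemma is_coef_approx x F n c l e :
  (forall s, complex.Re s = x -> normc (F s - dp_eval l s) <= e) ->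
  is_coef x F n c -> normc (c - dp_coef l n) <= e * expR (x * ln n.+1%:R).
Proof.
move=> Fl cF; apply: (is_coef_bound Fl).
have := is_coefD cF (is_coefZ (-1) (is_coef_dp x l n)).
by rewrite mulN1r; apply: eq_is_coef => s _; rewrite mulN1r.
Qed.

(** Transports identities between coefficients, which for polynomials can be
read off the lists of terms, to uniform limits. *)
Lemma is_coef_transfer x F n c y G m d :
  (forall e, 0 < e -> exists l l', [/\
     forall s, complex.Re s = x -> normc (F s - dp_eval l s) <= e,
     forall s, complex.Re s = y -> normc (G s - dp_eval l' s) <= e &
     dp_coef l n = dp_coef l' m]) ->
  is_coef x F n c -> is_coef y G m d -> c = d.
Proof.
move=> h cF cG; apply/eqP; rewrite -subr_eq0; apply/eqP/eq0_normc/eqP.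
rewrite eq_le normc_ge0 andbT; apply/ler_addgt0Pr => e e0; rewrite add0r.
set K := expR (x * ln n.+1%:R) + expR (y * ln m.+1%:R).
have K0 : 0 < K by rewrite addr_gt0 ?expR_gt0.
have [l [l' [hl hl' ll']]] := h (e / K) (divr_gt0 e0 K0).
apply: le_trans (normc_distD (dp_coef l n) _ _) _.
have -> : e = e / K * expR (x * ln n.+1%:R) + e / K * expR (y * ln m.+1%:R).
  by rewrite -mulrDr divfK ?gt_eqF.
by rewrite lerD ?(is_coef_approx hl cF)// ll' normc_distC (is_coef_approx hl' cG).
Qed.

(** The coefficients of approximating polynomials form a Cauchy sequence, since a
coefficient is controlled by a supremum on a line.  Their limit is the mean value
on every line, because the approximation holds on the whole half-plane. *)
Lemma bohr_has_coef x F : bohr x F ->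
  exists a : nat -> R[i], forall y n, x < y -> is_coef y F n (a n).
Proof.
move=> bF; have e_gt0 k : 0 < k.+1%:R^-1 :> R by rewrite invr_gt0 ltr0n.
have [l hl] := choice (fun k => bF _ (e_gt0 k)).
have lc n : exists a, tends (fun k => dp_coef (l k) n) a.
  apply: tends_complete => e e0.
  set K := expR ((x + 1) * ln n.+1%:R).
  have K0 : 0 < K by exact: expR_gt0.
  exists (Num.truncn (2 * K / e)) => k k' hk hk'.
  have := @is_coefD (x + 1) _ _ n _ _ (is_coef_dp _ (l k) n)
    (is_coefZ (-1) (is_coef_dp _ (l k') n)).
  rewrite mulN1r => /(is_coef_bound (B := e / K)); rewrite divfK ?gt_eqF//; apply=> s sx.
  have xs : x < complex.Re s by rewrite sx ltrDl.
  rewrite mulN1r; apply: le_trans (normc_distD (F s) _ _) _.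
  have le_e j : (Num.truncn (2 * K / e) <= j)%N -> j.+1%:R^-1 <= e / K / 2.
    move=> hj; rewrite -[leRHS]invrK lef_pV2 ?posrE ?invr_gt0 ?divr_gt0 ?ltr0n//.
    have -> : (e / K / 2)^-1 = 2 * K / e by field; rewrite !gt_eqF.
    by apply: le_trans (ltW (truncnS_gt _)) _; rewrite ler_nat ltnS.
  rewrite [leRHS]splitr normc_distC.
  by rewrite lerD ?(le_trans (hl _ _ xs)) ?le_e.
have [a ha] := choice lc.
exists a => y n xy e e0.
set K := expR (y * ln n.+1%:R).
have K0 : 0 < K by exact: expR_gt0.
have e30 : 0 < e / 3 by rewrite divr_gt0.
have [k [kK ka]] : exists k, k.+1%:R^-1 * K <= e / 3 /\
    normc (dp_coef (l k) n - a n) <= e / 3.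
  have [N hN] := ha n _ e30.
  exists (maxn N (Num.truncn (3 * K / e))); split; last by rewrite hN// leq_maxl.
  rewrite mulrC ler_pdivrMr ?ltr0n// -ler_pdivrMl//.
  rewrite (_ : (e / 3)^-1 * K = 3 * K / e); last by field; rewrite gt_eqF.
  by apply: le_trans (ltW (truncnS_gt _)) _; rewrite ler_nat ltnS leq_maxr.
have [N hN] := is_coef_dp y (l k) n e30.
exists N => M NM.
apply: le_trans (normc_distD (dp_coef (l k) n) _ _) _.
have -> : e = e / 3 + e / 3 + e / 3 by field.
rewrite lerD//; apply: le_trans (normc_distD (line_avg y M
  (fun s => dp_eval (l k) s * npow n.+1 (- s))) _ _) _.
rewrite lerD ?hN//; apply: le_trans kK.
rewrite -mulN1r -line_avgZ -line_avgD; apply: normc_line_avg => s sy.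
rewrite mulN1r -mulrBl normcM normc_npow ReN mulNr opprK sy.
by rewrite ler_wpM2r ?expR_ge0// hl// sy.
Qed.

Lemma bohr_coef_line x F y y' n c : bohr x F -> x < y -> x < y' ->
  is_coef y F n c -> is_coef y' F n c.
Proof.
move=> /bohr_has_coef[a ha] xy xy' cF.
by rewrite (is_coef_uniq cF (ha y n xy)); exact: ha.
Qed.

Lemma is_coef_shift x y G d n c c' : (0 < d)%N -> 0 <= x -> x < y -> bohr x G ->
  is_coef y G n c ->
  is_coef y (fun s => npow d s * G s) (d * n.+1).-1 c' -> c' = c.
Proof.
move=> d0 x0 xy bG cG cF; apply: is_coef_transfer cF cG => e /bG[l hl].
exists (dp_shift d l), l; split=> [s sy|s sy|]; last exact: dp_coef_shift.
  rewrite dp_eval_shift// -mulrBr normcM; have xs : x < complex.Re s by rewrite sy.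
  apply: le_trans (hl _ xs); rewrite ler_piMl ?normc_ge0// normc_npow_le1//.
  by rewrite (le_trans x0)// ltW.
by apply: hl; rewrite sy.
Qed.

Lemma is_coef_shift0 x y G d n c : (0 < d)%N -> ~~ (d %| n.+1)%N -> 0 <= x ->
  x < y -> bohr x G -> is_coef y (fun s => npow d s * G s) n c -> c = 0.
Proof.
move=> d0 dn x0 xy bG cF.
have c0 := is_coef_dp y [::] n; rewrite /dp_coef big_nil in c0.
apply: is_coef_transfer cF c0 => e e0; have [l hl] := bG _ e0.
exists (dp_shift d l), [::]; split=> [s sy|s sy|]; last 1 first.
- by rewrite dp_coef_shift0// /dp_coef big_nil.
- rewrite dp_eval_shift// -mulrBr normcM; have xs : x < complex.Re s by rewrite sy.
  apply: le_trans (hl _ xs); rewrite ler_piMl ?normc_ge0// normc_npow_le1//.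
  by rewrite (le_trans x0)// ltW.
- by rewrite subrr normc0 ltW.
Qed.

Lemma is_coef_dilate x y G k n c c' : (0 < k)%N -> 0 <= x -> x < y -> bohr x G ->
  is_coef y G n c ->
  is_coef y (fun s => G (k%:R * s)) (n.+1 ^ k).-1 c' -> c' = c.
Proof.
move=> k0 x0 xy bG cG cF; apply: is_coef_transfer cF cG => e /bG[l hl].
exists (dp_dilate k l), l; split=> [s sy|s sy|]; last exact: dp_coef_dilate.
  rewrite dp_eval_dilate; apply: hl.
  rewrite -(rmorph_nat (real_complex R)) Re_realM sy (lt_le_trans xy)//.
  by rewrite ler_peMl ?ler1n// (le_trans x0)// ltW.
by apply: hl; rewrite sy.
Qed.

Lemma is_coef_dilate0 x y G k n c : (0 < k)%N -> (forall j, (j.+1 ^ k)%N <> n.+1) ->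
  0 <= x -> x < y -> bohr x G -> is_coef y (fun s => G (k%:R * s)) n c -> c = 0.
Proof.
move=> k0 kn x0 xy bG cF.
have c0 := is_coef_dp y [::] n; rewrite /dp_coef big_nil in c0.
apply: is_coef_transfer cF c0 => e e0; have [l hl] := bG _ e0.
exists (dp_dilate k l), [::]; split=> [s sy|s sy|]; last 1 first.
- by rewrite dp_coef_dilate0// /dp_coef big_nil.
- rewrite dp_eval_dilate; apply: hl.
  rewrite -(rmorph_nat (real_complex R)) Re_realM sy (lt_le_trans xy)//.
  by rewrite ler_peMl ?ler1n// (le_trans x0)// ltW.
- by rewrite subrr normc0 ltW.
Qed.

(** The functions without constant term form an ideal: multiplying by [m^(-s)],
[m > 1], cannot create a constant term. *)
Lemma is_coef0_ideal x y F G c : 0 <= x -> x < y -> bohr x F -> bohr x G ->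
  is_coef y F 0 0 -> is_coef y (fun s => F s * G s) 0 c -> c = 0.
Proof.
move=> x0 xy bF bG F0 FGc.
have F_npow m : is_coef y (fun s => F s * npow m.+1 s) 0 0.
  case: m => [|m].
    by apply: eq_is_coef F0 => s _; rewrite npow1 mulr1.
  have [a ha] := bohr_has_coef (bohrM x0 (bohr_npow x (ltn0Sn m.+1)) bF).
  have := ha y 0 xy; rewrite (is_coef_shift0 _ _ x0 xy bF (ha y 0 xy))//.
  by apply: eq_is_coef => s _; rewrite mulrC.
have F_dp l : is_coef y (fun s => F s * dp_eval l s) 0 0.
  rewrite -[X in is_coef _ _ _ X](_ : \sum_(t <- l) t.1 * 0 = 0).
    2: by apply: big1 => t _; rewrite mulr0.
  have := is_coef_sum l (fun t => is_coefZ t.1 (F_npow t.2)).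
  apply: eq_is_coef => s _; rewrite mulr_sumr; apply: eq_bigr => t _.
  by rewrite mulrCA.
have [B B0 FB] := bohr_bounded x0 bF.
apply/eq0_normc/eqP; rewrite eq_le normc_ge0 andbT.
apply/ler_addgt0Pr => e e0; rewrite add0r.
have [l hl] := bG (e / (B + 1)) (divr_gt0 e0 (ltr_wpDl B0 ltr01)).
have := is_coefD FGc (is_coefZ (-1) (F_dp l)).
rewrite mulr0 addr0 => /(is_coef_bound (B := e)).
rewrite ln1 mulr0 expR0 mulr1; apply=> s sy; have xs : x < complex.Re s by rewrite sy.
rewrite mulN1r -mulrBr normcM; apply: le_trans (mul_div_addr1_le B0 (ltW e0)).
by rewrite ler_pM ?normc_ge0 ?FB ?hl.
Qed.

Lemma conjc_expC z : conjc (expC z) = expC (conjc z).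
Proof.
by case: z => b d; rewrite /expC rmorphM /= cosN sinN oppr0.
Qed.

(** With [S] the sum of the first terms, average
[|F|^2 >= Re ((2F - S) conj S)]; on the line, [conj (n^(-s)) = n^(-2x) n^s], so that
the mean of the right-hand side is a combination of coefficients. *)
Lemma is_coef_bessel x F (a : nat -> R[i]) B L :
  (forall s, complex.Re s = x -> normc (F s) <= B) ->
  (forall n, is_coef x F n (a n)) ->
  \sum_(n < L) (normc (a n) ^+ 2 * expR (- (2 * x * ln n.+1%:R))) <= B ^+ 2.
Proof.
move=> FB aF; pose S s := \sum_(n < L) a n * npow n.+1 s.
have cS (n : 'I_L) : is_coef x S n (a n).
  rewrite (_ : a n = \sum_(m < L) a m * ((m : nat) == n)%:R).
    by apply: is_coef_sum => m; apply: is_coefZ; exact: is_coef_npow.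
  rewrite (bigD1 n)//= eqxx mulr1 big1 ?addr0// => m mn.
  by rewrite (negbTE mn : (m == n :> nat) = false) mulr0.
pose w (n : nat) : R := expR (- (2 * x * ln n.+1%:R)).
have conj_npow n s : complex.Re s = x ->
    conjc (npow n.+1 s) = (w n)%:C * npow n.+1 (- s).
  move=> sx; have -> : conjc (npow n.+1 s) = npow n.+1 (conjc s).
    rewrite /npow conjc_expC; congr expC; case: s {sx} => t u.
    by apply/eqP; rewrite eq_complex /=; apply/andP; split; apply/eqP; ring.
  have -> : conjc s = (2 * x)%:C - s.
    case: s sx => t u /= ->; apply/eqP; rewrite eq_complex /=.
    by apply/andP; split; apply/eqP; ring.
  rewrite npowD; congr (_ * _).
  by rewrite /npow /expC /= !mulr0 subr0 mul0r addr0 oppr0 cos0 sin0 mulr1.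
have lim_real : complex.Re (\sum_(n < L) conjc (a n) * (w n)%:C * a n)
    = \sum_(n < L) (normc (a n) ^+ 2 * expR (- (2 * x * ln n.+1%:R))).
  rewrite (big_morph _ (@ReD R) (erefl : complex.Re 0 = 0)); apply: eq_bigr => n _.
  rewrite mulrAC mulrC Re_realM mulrC /w; congr (_ * _).
  by case: (a n) => b d /=; rewrite sqr_sqrtr ?addr_ge0 ?sqr_ge0//; ring.
rewrite -lim_real; pose G s := F s + (F s + -1 * S s).
apply: (@tends_Re_le _ (fun M => line_avg x M (fun s => G s * conjc (S s)))) => [M|].
  apply: Re_line_avg_le => s /FB FsB.
  apply: le_trans (_ : normc (F s) ^+ 2 <= _); last first.
    by rewrite lerXn2r ?nnegrE ?normc_ge0// (le_trans (normc_ge0 _) FsB).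
  rewrite /G; case: (F s) => b d; case: (S s) => b' d' /=.
  rewrite sqr_sqrtr ?addr_ge0 ?sqr_ge0// -subr_ge0.
  rewrite [X in 0 <= X](_ : _ = (b - b') ^+ 2 + (d - d') ^+ 2); last by ring.
  by rewrite addr_ge0 ?sqr_ge0.
have cG (n : 'I_L) : is_coef x G n (a n).
  have := is_coefD (aF n) (is_coefD (aF n) (is_coefZ (-1) (cS n))).
  by rewrite mulN1r subrr addr0.
have := tends_sum (index_enum 'I_L) (fun n : 'I_L =>
  tendsZ (conjc (a n) * (w n)%:C) (cG n)).
apply: tends_ext => M.
under eq_bigr do rewrite -line_avgZ.
rewrite -line_avg_sum; apply: eq_line_avg => s sx.
rewrite (_ : conjc (S s) = \sum_(n < L) conjc (a n) * conjc (npow n.+1 s)).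
  rewrite mulr_sumr; apply: eq_bigr => n _.
  by rewrite conj_npow//; ring.
by rewrite rmorph_sum; apply: eq_bigr => n _; exact: rmorphM.
Qed.

End BohrCoefficients.

(** * Dirichlet series with square summable coefficients *)

Section HardySpaceBasics.
Variable R : realType.
Implicit Types (x y e B : R) (s z c : R[i]) (n m M N K : nat).
Implicit Types (a : nat -> R[i]) (f g : H2 R).

Lemma tends_limn (u : nat -> R[i]) c : tends u c -> limn u = c.
Proof.
move=> uc; apply/cvg_lim; first exact: norm_hausdorff.
apply/cvgrPdist_le => e e0.
have eE : e = (complex.Re e)%:C by rewrite RRe_real// realE ltW.
have e0' : 0 < complex.Re e by rewrite -ltcR -eE.
have [N hN] := uc _ e0'; exists N => // n /= Nn.
have -> : `|c - u n| = (normc (c - u n))%:C by case: (c - u n).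
by rewrite eE lecR normc_distC hN.
Qed.

Lemma cvg_uniform_tends (A : set R[i]) (u : nat -> R[i] -> R[i])
    (F : R[i] -> R[i]) e : 0 < e ->
  {uniform A, u @ \oo --> F} ->
  exists N, forall n, (N <= n)%N -> forall s, A s -> normc (F s - u n s) <= e.
Proof.
move=> e0 uF; have eC : 0 < (e%:C : R[i]) by rewrite ltcR.
pose E : set (R[i] * R[i]) := [set p | ball p.1 e%:C p.2].
have entE : entourage E by exact: (entourage_ball _ (PosNum eC)).
have /uF[N _ hN] : nbhs (F : {uniform` A -> R[i]}) [set h | forall s, A s -> E (F s, h s)].
  by apply/uniform_nbhs; exists E; split.
exists N => n Nn s As; have := hN n Nn s As.
rewrite /E /= -ball_normE /=.
have -> : `|F s - u n s| = (normc (F s - u n s))%:C by case: (F s - u n s).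
by rewrite ltcR => /ltW.
Qed.

Definition partial_dp a N : dpoly R := [seq (a n, n) | n <- index_iota 0 N].

Lemma partial_dpE a N s : dp_eval (partial_dp a N) s = dirichlet_partial a N s.
Proof. by rewrite /dp_eval big_map. Qed.

Lemma partial_dp_coef a N n : (n < N)%N -> dp_coef (partial_dp a N) n = a n.
Proof.
move=> nN; rewrite /dp_coef big_map big_mkcond /=.
rewrite (bigD1_seq n) ?mem_index_iota ?iota_uniq//= eqxx big1 ?addr0// => m.
by move/negbTE ->.
Qed.

Lemma sum_inv_sqr K M : \sum_(K <= n < M) (n.+1%:R ^+ 2)^-1 <= 2 / K.+1%:R :> R.
Proof.
have [KM|MK] := leqP K M; last first.
  by rewrite (big_geq (ltnW MK)) divr_ge0 ?ler0n.
apply: le_trans (_ : \sum_(K <= n < M) (2 / n.+1%:R - 2 / n.+2%:R) <= _).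
  apply: ler_sum => n _; have n0 : (0 : R) < n.+1%:R by rewrite ltr0n.
  have -> : n.+2%:R = n.+1%:R + 1 :> R by rewrite natr1.
  rewrite -subr_ge0 [X in 0 <= X](_ : _ =
    (n.+1%:R - 1) / (n.+1%:R ^+ 2 * (n.+1%:R + 1))).
    apply: divr_ge0; first by rewrite subr_ge0 ler1n.
    by rewrite mulr_ge0 ?exprn_ge0 ?addr_ge0.
  by field; rewrite !gt_eqF ?ltr_wpDr.
rewrite (eq_bigr (fun n => - (2 / n.+2%:R) - - (2 / n.+1%:R))) => [|n _].
  by rewrite telescope_sumr// opprK addrC gerBl divr_ge0.
by rewrite opprK addrC.
Qed.

Lemma dirichlet_tail a B K M s : (forall n, (K <= n)%N -> normc (a n) <= B) ->
    2 <= complex.Re s ->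
  normc (\sum_(K <= n < M) a n * npow n.+1 s)
    <= B * (2 / K.+1%:R) * expR (- ((complex.Re s - 2) * ln K.+1%:R)).
Proof.
move=> aB s2; have B0 : 0 <= B by apply: le_trans (normc_ge0 _) (aB K (leqnn _)).
apply: le_trans (normc_sum _ _ _) _.
set E := expR _; apply: le_trans (_ : \sum_(K <= n < M) B * (E * (n.+1%:R ^+ 2)^-1) <= _).
  rewrite big_nat_cond [leRHS]big_nat_cond; apply: ler_sum => n /andP[/andP[Kn _] _].
  rewrite normcM ler_pM ?normc_ge0 ?aB// normc_npow.
  have ln0 : 0 < n.+1%:R :> R by rewrite ltr0n.
  have -> : (n.+1%:R ^+ 2)^-1 = expR (- (2 * ln n.+1%:R)) :> R.
    by rewrite expRN expRM_natl lnK.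
  rewrite /E -expRD ler_expR.
  have : ln K.+1%:R <= ln n.+1%:R :> R by rewrite ler_ln ?posrE ?ltr0n// ler_nat ltnS.
  move: (complex.Re s) s2 (ln n.+1%:R) (ln K.+1%:R) => t t2 u v uv.
  have : 0 <= (t - 2) * (u - v) by rewrite mulr_ge0// subr_ge0.
  nra.
rewrite -mulr_sumr -mulr_sumr mulrCA [leLHS]mulrC ler_wpM2r ?expR_ge0//.
rewrite ler_wpM2l//; exact: sum_inv_sqr.
Qed.


Lemma dirichlet_partialB a K M s : (K <= M)%N ->
  dirichlet_partial a M s - dirichlet_partial a K s =
    \sum_(K <= n < M) a n * npow n.+1 s.
Proof.
move=> KM; rewrite /dirichlet_partial (big_cat_nat (leq0n K) KM)/= [X in X - _]addrC.
by rewrite addrK.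
Qed.

Lemma tail_expR_le1 (t : R) n : 2 <= t -> expR (- ((t - 2) * ln n.+1%:R)) <= 1.
Proof.
by move=> t2; rewrite -[leRHS]expR0 ler_expR oppr_le0 mulr_ge0 ?ln_nat_ge0 ?subr_ge0.
Qed.

(** By comparison with [sum 1/(n+1)^2]; on [Re s >= 2] bounded coefficients
suffice. *)
Lemma dirichlet_sum_tends a B s : (forall n, normc (a n) <= B) ->
    2 <= complex.Re s ->
  tends (fun N => dirichlet_partial a N s) (dirichlet_sum a s).
Proof.
move=> aB s2; have B0 : 0 <= B by apply: le_trans (normc_ge0 _) (aB 0).
have step K M : (K <= M)%N ->
    normc (dirichlet_partial a M s - dirichlet_partial a K s) <= 2 * B / K.+1%:R.
  move=> KM; rewrite dirichlet_partialB//.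
  apply: le_trans (dirichlet_tail M (fun n _ => aB n) s2) _.
  have -> : 2 * B / K.+1%:R = B * (2 / K.+1%:R) * 1.
    by rewrite mulr1 mulrA (mulrC B).
  rewrite ler_wpM2l ?tail_expR_le1//.
  by rewrite mulr_ge0 // divr_ge0.
have [|c hc] := @tends_complete _ (fun N => dirichlet_partial a N s); last first.
  by rewrite /dirichlet_sum (tends_limn hc).
move=> e e0; pose N := Num.truncn (2 * B / e * 2).
have hN n : (N <= n)%N -> 2 * B / n.+1%:R <= e / 2.
  move=> Nn; rewrite ler_pdivrMr ?ltr0n// -ler_pdivrMl ?divr_gt0//.
  have -> : (e / 2)^-1 * (2 * B) = 2 * B / e * 2 by field; rewrite gt_eqF.
  by apply: le_trans (ltW (truncnS_gt _)) _; rewrite ler_nat ltnS.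
exists N => n m Nn Nm.
apply: le_trans (normc_distD (dirichlet_partial a N s) _ _) _.
rewrite [e]splitr lerD//; first exact: le_trans (step _ _ Nn) (hN _ (leqnn _)).
by rewrite normc_distC; exact: le_trans (step _ _ Nm) (hN _ (leqnn _)).
Qed.

Lemma dirichlet_sum_tail a B K s : (forall n, normc (a n) <= B) ->
    2 <= complex.Re s ->
  normc (dirichlet_sum a s - dirichlet_partial a K s)
    <= B * (2 / K.+1%:R) * expR (- ((complex.Re s - 2) * ln K.+1%:R)).
Proof.
move=> aB s2; have sc := dirichlet_sum_tends aB s2.
set C := B * _ * _.
apply/ler_addgt0Pr => e e0; have [N hN] := sc _ e0.
apply: le_trans (normc_distD (dirichlet_partial a (maxn N K) s) _ _) _.
rewrite addrC lerD//; last by rewrite normc_distC hN// leq_maxl.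
rewrite dirichlet_partialB ?leq_maxr//.
exact: dirichlet_tail (fun n _ => aB n) s2.
Qed.

Lemma dirichlet_sum_bounded a B s : (forall n, normc (a n) <= B) ->
  2 <= complex.Re s -> normc (dirichlet_sum a s) <= 2 * B.
Proof.
move=> aB s2; have := dirichlet_sum_tail 0 aB s2.
rewrite /dirichlet_partial big_geq// subr0 ln1 mulr0 oppr0 expR0 mulr1 divr1.
by rewrite mulrC.
Qed.

Lemma dirichlet_sum_bohr a B : (forall n, normc (a n) <= B) ->
  bohr 2 (dirichlet_sum a).
Proof.
move=> aB e e0; have B0 : 0 <= B by apply: le_trans (normc_ge0 _) (aB 0).
pose N := Num.truncn (2 * B / e).
exists (partial_dp a N) => s s2; rewrite partial_dpE.
apply: le_trans (dirichlet_sum_tail N aB (ltW s2)) _.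
apply: le_trans (_ : B * (2 / N.+1%:R) * 1 <= _).
  by rewrite ler_wpM2l ?(tail_expR_le1 _ (ltW s2))// mulr_ge0// divr_ge0.
rewrite mulr1 mulrA ler_pdivrMr ?ltr0n// -ler_pdivrMl// mulrC (mulrC B).
exact: ltW (truncnS_gt _).
Qed.

Lemma is_coef_dirichlet_sum a B x n : (forall n, normc (a n) <= B) -> 2 < x ->
  is_coef x (dirichlet_sum a) n (a n).
Proof.
move=> aB x2; have [c hc] := bohr_has_coef (dirichlet_sum_bohr aB).
suff <- : c n = a n by exact: hc.
have an := is_coef_dp x [:: (a n, n)] n; rewrite /dp_coef big_mkcond big_seq1 eqxx in an.
apply: is_coef_transfer (hc x n x2) an => e e0.
have B0 : 0 <= B by apply: le_trans (normc_ge0 _) (aB 0).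
pose N := maxn n.+1 (Num.truncn (2 * B / e)).
exists (partial_dp a N), [:: (a n, n)]; split=> [s sx|s _|]; last 1 first.
- by rewrite partial_dp_coef ?leq_maxl// /dp_coef big_mkcond big_seq1 eqxx.
- rewrite partial_dpE; have s2 : 2 <= complex.Re s by rewrite sx ltW.
  apply: le_trans (dirichlet_sum_tail N aB s2) _.
  apply: le_trans (_ : B * (2 / N.+1%:R) * 1 <= _).
    by rewrite ler_wpM2l ?tail_expR_le1// mulr_ge0// divr_ge0.
  rewrite mulr1 mulrA ler_pdivrMr ?ltr0n// -ler_pdivrMl// mulrC (mulrC B).
  by apply: le_trans (ltW (truncnS_gt _)) _; rewrite ler_nat ltnS leq_maxr.
- by rewrite subrr normc0 ltW.
Qed.

Lemma sqnorm_partial_le f L : \sum_(n < L) normc (f n) ^+ 2 <= H2norm f ^+ 2.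
Proof.
have fin : (sqnorm f < +oo)%E by case: f.
have ge0 n : (0 <= (normc (f n) ^+ 2)%:E)%E by rewrite lee_fin sqr_ge0.
have s0 : (0 <= sqnorm f)%E by exact: nneseries_ge0.
rewrite /H2norm sqr_sqrtr ?fine_ge0// -lee_fin fineK ?ge0_fin_numE//.
rewrite -sumEFin /sqnorm.
have := nneseries_lim_ge L (fun n (_ : (0 <= n)%N) (_ : xpredT n) => ge0 n).
by rewrite big_mkord.
Qed.

Lemma H2norm_ge0 f : 0 <= H2norm f. Proof. exact: sqrtr_ge0. Qed.

Lemma H2coef_le f n : normc (f n) <= H2norm f.
Proof.
rewrite -(ler_pXn2r (n := 2))// ?nnegrE ?normc_ge0 ?H2norm_ge0//.
apply: le_trans (sqnorm_partial_le f n.+1).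
by rewrite big_ord_recr lerDr sumr_ge0// => i _; rewrite sqr_ge0.
Qed.

Lemma sqnorm_le a B : (forall L, \sum_(n < L) normc (a n) ^+ 2 <= B) ->
  (sqnorm a <= B%:E)%E.
Proof.
move=> aB; apply: lime_le.
  by apply: is_cvg_nneseries => n _ _; rewrite lee_fin sqr_ge0.
apply: nearW => L; rewrite big_mkord sumEFin lee_fin; exact: aB.
Qed.

Lemma sqsummable_bounded a B : (forall L, \sum_(n < L) normc (a n) ^+ 2 <= B) ->
  a \in @sqsummable R.
Proof. by move=> /sqnorm_le aB; rewrite unfold_in (le_lt_trans aB)// ltry. Qed.

Lemma H2norm_le f B : 0 <= B -> (forall L, \sum_(n < L) normc (f n) ^+ 2 <= B ^+ 2) ->
  H2norm f <= B.
Proof.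
move=> B0 /sqnorm_le fB; have s0 : (0 <= sqnorm f)%E.
  by apply: nneseries_ge0 => n _ _; rewrite lee_fin sqr_ge0.
rewrite /H2norm -[B]ger0_norm// -sqrtr_sqr ler_sqrt ?sqr_ge0//.
rewrite -lee_fin fineK// ge0_fin_numE//; exact: le_lt_trans fB (ltry _).
Qed.

Lemma H2eval_tends f s : 2 <= complex.Re s ->
  tends (fun N => dirichlet_partial f N s) (H2eval f s).
Proof. exact: dirichlet_sum_tends (H2coef_le f). Qed.

Lemma H2eval_bounded f s : 2 <= complex.Re s -> normc (H2eval f s) <= 2 * H2norm f.
Proof. exact: dirichlet_sum_bounded (H2coef_le f). Qed.

Lemma H2eval_bohr f : bohr 2 (H2eval f).
Proof. exact: dirichlet_sum_bohr (H2coef_le f). Qed.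

Lemma is_coef_H2eval f x n : 2 < x -> is_coef x (H2eval f) n (f n).
Proof. exact: is_coef_dirichlet_sum (H2coef_le f). Qed.

Lemma H2coefZD c f g n : (c *: f + g) n = c * f n + g n.
Proof. by []. Qed.

Lemma H2evalZD c f g s : 2 <= complex.Re s ->
  H2eval (c *: f + g) s = c * H2eval f s + H2eval g s.
Proof.
move=> s2; apply: tends_uniq (H2eval_tends _ s2) _.
apply: tends_ext (tendsD (tendsZ c (H2eval_tends f s2)) (H2eval_tends g s2)) => N.
rewrite /dirichlet_partial mulr_sumr -big_split; apply: eq_bigr => n _ /=.
by rewrite mulrDl mulrA.
Qed.

Lemma H2eq f g : (forall n, f n = g n) -> f = g.
Proof. by move=> fg; apply/val_inj/funext. Qed.

Lemma sum_delta_sqnorm k L : \sum_(n < L) normc ((n == k :> nat)%:R : R[i]) ^+ 2 <= 1.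
Proof.
have [kL|Lk] := ltnP k L.
  rewrite (bigD1 (Ordinal kL))//= eqxx normc1 expr1n big1 ?addr0// => n nk.
  rewrite (_ : (n == k :> nat) = false) ?normc0 ?expr0n//.
  exact: negbTE.
rewrite big1 // => n _; rewrite (_ : (n == k :> nat) = false) ?normc0 ?expr0n//.
by apply/negbTE; rewrite neq_ltn (leq_trans (ltn_ord n) Lk).
Qed.

Definition H2mono (k : nat) : H2 R :=
  @MkH2 R (fun n => (n == k)%:R) (sqsummable_bounded (sum_delta_sqnorm k)).

Lemma H2monoE k n : H2mono k n = (n == k)%:R. Proof. by []. Qed.

Lemma H2mono_eval k s : H2eval (H2mono k) s = npow k.+1 s.
Proof.
apply: tends_limn => e e0; exists k.+1 => N kN.
rewrite /dirichlet_partial (bigD1_seq k) ?iota_uniq ?mem_index_iota//=.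
rewrite eqxx mul1r big1 ?addr0 ?subrr ?normc0 ?ltW// => n /negbTE nk.
by rewrite nk mul0r.
Qed.

Lemma H2dot_mono f k : H2dot f (H2mono k) = f k.
Proof.
apply: tends_limn => e e0; exists k.+1 => N kN.
rewrite (bigD1_seq k) ?iota_uniq ?mem_index_iota//=.
rewrite eqxx rmorph1 mulr1 big1 ?addr0 ?subrr ?normc0 ?ltW// => n /negbTE nk.
by rewrite nk rmorph0 mulr0.
Qed.

End HardySpaceBasics.

(** * The symbol *)

Section Symbol.
Variables (R : realType) (phi : Gpos R).
Implicit Types (x y e B : R) (s z c : R[i]) (n m M N K : nat).
Implicit Types (F G : R[i] -> R[i]).

Let psi := dirichlet_sum (Gcoef phi).

Lemma GfunE s : phi s = (char phi)%:R * s + psi s. Proof. by []. Qed.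

Lemma Re_natM n s : complex.Re (n%:R * s) = n%:R * complex.Re s.
Proof. by rewrite -(rmorph_nat (real_complex R)) Re_realM. Qed.

Lemma psi_approx x e : 0 < x -> 0 < e -> exists N, forall n, (N <= n)%N ->
  forall s, x < complex.Re s -> normc (psi s - dirichlet_partial (Gcoef phi) n s) <= e.
Proof.
move=> x0 e0; have [N hN] := cvg_uniform_tends e0 (@Gcoef_unif _ phi _ x0).
by exists N => n Nn s xs; exact: hN.
Qed.

Lemma psi_bohr x : 0 < x -> bohr x psi.
Proof.
move=> x0 e e0; have [N hN] := psi_approx x0 e0.
by exists (partial_dp (Gcoef phi) N) => s xs; rewrite partial_dpE hN.
Qed.

Lemma is_coef_psi x n : 0 < x -> is_coef x psi n (Gcoef phi n).
Proof.
move=> x0; have x20 : 0 < x / 2 by rewrite divr_gt0.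
have xx2 : x / 2 < x by rewrite ltr_pdivrMr// ltr_pMr// ltr1n.
have [c hc] := bohr_has_coef (psi_bohr x20).
suff <- : c n = Gcoef phi n by exact: hc.
have an := is_coef_dp x [:: (Gcoef phi n, n)] n.
rewrite /dp_coef big_mkcond big_seq1 eqxx in an.
apply: is_coef_transfer (hc x n xx2) an => e e0.
have [N hN] := psi_approx x20 e0.
exists (partial_dp (Gcoef phi) (maxn n.+1 N)), [:: (Gcoef phi n, n)].
split=> [s sx|s _|]; last 1 first.
- by rewrite partial_dp_coef ?leq_maxl// /dp_coef big_mkcond big_seq1 eqxx.
- by rewrite partial_dpE hN ?leq_maxr// sx.
- by rewrite subrr normc0 ltW.
Qed.

Lemma Re_psi_ge0 s : 0 < complex.Re s -> 0 <= complex.Re (psi s).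
Proof.
move=> s0; have [[t ht]|h] := @Gcoef_range _ phi; first by rewrite /psi ht.
by apply/ltW; apply: (h (psi s)); exists s.
Qed.

Lemma Re_Gfun_ge s : 0 < complex.Re s ->
  (char phi)%:R * complex.Re s <= complex.Re (phi s).
Proof. by move=> s0; rewrite GfunE ReD Re_natM lerDl Re_psi_ge0. Qed.

Lemma Re_Gfun_ge_id s : 0 < complex.Re s -> complex.Re s <= complex.Re (phi s).
Proof.
move=> s0; apply: le_trans (Re_Gfun_ge s0).
by rewrite ler_peMl ?(ltW s0)// ler1n char_ge1.
Qed.

Lemma Re_iter_Gfun_ge k s : 0 < complex.Re s ->
  ((char phi) ^ k)%:R * complex.Re s <= complex.Re (iter k phi s).
Proof.
move=> s0; elim: k => [|k IH]; first by rewrite mul1r.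
have c0 : (0 : R) < (char phi ^ k)%:R by rewrite ltr0n expn_gt0 char_ge1.
have s'0 : 0 < complex.Re (iter k phi s).
  by apply: lt_le_trans IH; rewrite mulr_gt0.
rewrite iterS expnS natrM -mulrA; apply: le_trans (Re_Gfun_ge s'0).
by rewrite ler_wpM2l ?ler0n.
Qed.

Lemma bohr_Gfun x F : 0 < x -> bohr x F -> bohr x (fun s => F (phi s)).
Proof.
move=> x0 bF; apply: (bohr_comp (ltW x0) bF (psi_bohr x0)) => s xs.
rewrite -GfunE; apply: lt_le_trans (Re_Gfun_ge_id _) => //.
exact: lt_trans xs.
Qed.

Lemma bohr_iter_Gfun x F k : 0 < x -> bohr x F -> bohr x (fun s => F (iter k phi s)).
Proof.
move=> x0; elim: k F => [//|k IH] F bF.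
by have := IH _ (bohr_Gfun x0 bF).
Qed.

(** Far to the right [psi] is a contraction, because its nonconstant terms are
dominated by [2^(-s)]. *)
Lemma psi_lipschitz D : exists X : nat, forall s z,
  X%:R <= complex.Re s -> X%:R <= complex.Re z -> normc (s - z) <= D%:R ->
  normc (psi s - psi z) <= 2^-1 * normc (s - z).
Proof.
have h0 : (0 : R) < 2^-1 by rewrite invr_gt0.
have [B B0 psiB] := bohr_bounded (ltW h0) (psi_bohr h0).
have cB n : normc (Gcoef phi n) <= B * n.+1%:R.
  have -> : n.+1%:R = expR (1 * ln n.+1%:R) :> R by rewrite mul1r lnK// posrE ltr0n.
  apply: (is_coef_bound _ (is_coef_psi n ltr01)) => s s1; apply: psiB.
  by rewrite s1 invf_lt1// ltr1n.
pose Y := Num.truncn (14 * B).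
have Y14 : 14 * B <= 2 ^+ Y.
  apply: le_trans (ltW (truncnS_gt _)) _; rewrite -natrX ler_nat.
  exact: ltn_expl.
(* the Lipschitz constant of [(n+1)^(-s)] is [O((n+1)^(2D+1-X))] and [|c_n|] is
   [O(n+1)]: beyond [2D], the exponent 4 leaves [(n+1)^(-2)], which is summable,
   and [Y] makes the total constant small since [(n+1)^(-Y) <= 2^(-Y)] *)
exists (D.*2 + 4 + Y)%N => s z sX zX szD; set h := normc (s - z).
have X0 : (0 : R) < (D.*2 + 4 + Y)%:R by rewrite ltr0n addnAC addn4.
have [hs hz] : 0 < complex.Re s /\ 0 < complex.Re z.
  by split; [exact: lt_le_trans sX|exact: lt_le_trans zX].
have term n : (1 <= n)%N ->
    normc (Gcoef phi n * npow n.+1 s - Gcoef phi n * npow n.+1 z)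
      <= h / 2 * (n.+1%:R ^+ 2)^-1.
  move=> n1; have n0 : (0 : R) < n.+1%:R by rewrite ltr0n.
  have n2 : (2 : R) <= n.+1%:R by rewrite ler_nat ltnS.
  have l0 : 0 <= ln n.+1%:R :> R by exact: ln_nat_ge0.
  have ll : ln n.+1%:R <= n.+1%:R :> R.
    by have := expR_ge1Dx (ln n.+1%:R : R); rewrite lnK ?posrE//; lra.
  rewrite -mulrBr normcM.
  have -> : npow n.+1 s - npow n.+1 z = npow n.+1 z * (npow n.+1 (s - z) - 1).
    by rewrite mulrBr mulr1 -npowD [z + _]addrC subrK.
  rewrite normcM.
  have e1 : normc (npow n.+1 (s - z) - 1) <= 7 * h * n.+1%:R ^+ (D.*2).+1.
    apply: le_trans (expC_sub1 _) _.
    have -> : normc (- ((s - z) * (ln n.+1%:R)%:C)) = h * ln n.+1%:R.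
      by rewrite normcN normcM normc_real ger0_norm.
    rewrite exprS [leRHS]mulrA ler_pM ?expR_ge0 ?mulr_ge0 ?normc_ge0//.
      by rewrite mulrA ler_wpM2l ?mulr_ge0 ?normc_ge0.
    rewrite -[n.+1%:R in leRHS]lnK ?posrE// -expRM_natl ler_expR mulrA ler_wpM2r//.
    by rewrite -muln2 natrM mulrC ler_wpM2r.
  have e2 := normc_npow_leX (ltn0Sn n) zX.
  have e3 := ler_pM (normc_ge0 _) (normc_ge0 _) e2 e1.
  apply: le_trans (ler_pM (normc_ge0 _) _ (cB n) e3) _.
    by rewrite mulr_ge0 ?normc_ge0.
  rewrite !exprD.
  have -> : B * n.+1%:R * ((n.+1%:R ^+ D.*2 * n.+1%:R ^+ 4 * n.+1%:R ^+ Y)^-1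
      * (7 * h * n.+1%:R ^+ (D.*2).+1)) =
    (14 * B / n.+1%:R ^+ Y) * (h / 2 * (n.+1%:R ^+ 2)^-1).
    rewrite [_ ^+ (D.*2).+1]exprS; have /lt0r_neq0 := n0; have := exprn_gt0 D.*2 n0.
    have := exprn_gt0 Y n0; set p := _ ^+ Y; set q := _ ^+ D.*2.
    move=> /lt0r_neq0 p0 /lt0r_neq0 q0; move: n.+1%:R p q p0 q0 => t p q p0 q0 t0.
    by field; rewrite p0 q0 t0.
  rewrite ler_piMl ?mulr_ge0 ?invr_ge0 ?exprn_ge0 ?normc_ge0//.
  rewrite ler_pdivrMr ?exprn_gt0// mul1r; apply: le_trans Y14 _.
  by rewrite lerXn2r ?nnegrE// ltW.
have partial M : normc (dirichlet_partial (Gcoef phi) M s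
    - dirichlet_partial (Gcoef phi) M z) <= 2^-1 * h.
  rewrite /dirichlet_partial -sumrB.
  case: M => [|M]; first by rewrite big_geq// normc0 mulr_ge0 ?normc_ge0// ltW.
  rewrite big_ltn// !npow1 subrr add0r; apply: le_trans (normc_sum _ _ _) _.
  apply: le_trans (_ : \sum_(1 <= n < M.+1) h / 2 * (n.+1%:R ^+ 2)^-1 <= _).
    rewrite big_nat_cond [leRHS]big_nat_cond; apply: ler_sum => n.
    by case/andP=> /andP[n1 _] _; exact: term.
  rewrite -mulr_sumr mulrC (mulrC 2^-1) -[leRHS]mul1r ler_wpM2r//.
    by rewrite mulr_ge0 ?normc_ge0// ltW.
  by apply: le_trans (sum_inv_sqr _ _ _) _; rewrite divff.
apply/ler_addgt0Pr => e e0; have e20 : 0 < e / 2 by rewrite divr_gt0.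
pose x := Num.min (complex.Re s) (complex.Re z) / 2.
have m0 : 0 < Num.min (complex.Re s) (complex.Re z) by rewrite lt_min hs hz.
have x0 : 0 < x by rewrite divr_gt0.
have xm : x < Num.min (complex.Re s) (complex.Re z).
  by rewrite ltr_pdivrMr// ltr_pMr// ltr1n.
have [N hN] := psi_approx x0 e20; have hN' := hN N (leqnn N).
move: xm; rewrite lt_min => /andP[xs xz].
apply: le_trans (normc_distD (dirichlet_partial (Gcoef phi) N s) _ _) _.
have -> : 2^-1 * h + e = e / 2 + (2^-1 * h + e / 2) by field.
rewrite lerD ?hN'//.
apply: le_trans (normc_distD (dirichlet_partial (Gcoef phi) N z) _ _) _.
by rewrite lerD// normc_distC hN'.
Qed.

End Symbol.

(** * Linearization of the symbol at infinity *)

Section Linearizer.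
Variables (R : realType) (phi : Gpos R).
Hypothesis char2 : (2 <= char phi)%N.
Implicit Types (s z : R[i]) (n m : nat).

Let psi := dirichlet_sum (Gcoef phi).
Let c0 : R[i] := (char phi)%:R.

(** Picard iterates for the equation of [exists_linearizer]. *)
Fixpoint linearizer_approx (j : nat) : R[i] -> R[i] :=
  if j is i.+1 then
    fun s => ((char phi)%:R)^-1 *
      (linearizer_approx i ((char phi)%:R * s)
       - dirichlet_sum (Gcoef phi) (s + linearizer_approx i s))
  else fun=> 0.

Lemma exp34_small (e : R) : 0 < e -> exists N, forall n, (N <= n)%N -> (3 / 4) ^+ n <= e.
Proof.
move=> e0; have q1 : `|3 / 4 : R| < 1.
  by rewrite ger0_norm ?divr_ge0// ltr_pdivrMr// mul1r ltr_nat.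
have /cvgrPdist_le /(_ _ e0)[N _ hN] := cvg_expr q1.
exists N => n Nn; have := hN n Nn; rewrite sub0r normrN; apply: le_trans.
exact: ler_norm.
Qed.

(** The inverse of the linearization of [phi] at infinity: [s + v(s)] conjugates
[s |-> c0 s], [c0] the characteristic, to [phi].  The equation
[c0 v(s) = v(c0 s) - psi(s + v(s))] is a contraction on bounded functions far to
the right, where [psi] is a contraction and [1/c0 <= 1/2]. *)
Lemma exists_linearizer : exists (K : nat) (v : R[i] -> R[i]),
  [/\ bohr K%:R v,
      forall s, K%:R < complex.Re s -> 2 < complex.Re (s + v s) &
      forall s, K%:R < complex.Re s -> phi (s + v s) = c0 * s + v (c0 * s)].
Proof.
have h0 : (0 : R) < 2^-1 by rewrite invr_gt0.
have h1 : (2^-1 : R) < 1 by rewrite invf_lt1// ltr1n.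
have [B0 B00 psiB0] := bohr_bounded (ltW h0) (psi_bohr phi h0).
pose b := (Num.truncn B0).+1; pose B : R := b%:R.
have B0B : B0 <= B by exact: ltW (truncnS_gt _).
have Bge0 : 0 <= B by exact: ler0n.
have psiB s : 2 <= complex.Re s -> normc (psi s) <= B.
  move=> s2; apply: le_trans B0B; apply: psiB0; apply: lt_le_trans s2.
  by apply: lt_trans h1 _; rewrite ltr1n.
have [X0 psiL] := psi_lipschitz phi b.*2.
(* [|v| <= B] is preserved by the iteration, so that on [Re s > X + B] the values
   [s + v(s)] stay where [psi] is a contraction *)
pose X := maxn 2 X0; pose K := (X + b)%N.
have X2 : (2 : R) <= X%:R by rewrite ler_nat leq_maxl.
have KE : K%:R = X%:R + B by rewrite natrD.
have K0 : (0 : R) <= K%:R by rewrite ler0n.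
have cR : (0 : R) < (char phi)%:R by rewrite ltr0n ltnW.
have c2 : (2 : R) <= (char phi)%:R by rewrite ler_nat.
have dil s : K%:R < complex.Re s -> K%:R < complex.Re (c0 * s).
  move=> Ks; rewrite Re_natM; apply: (lt_le_trans Ks).
  rewrite ler_peMl ?ler1n ?(ltnW char2)//; exact: le_trans (ltW Ks).
have nc z : normc ((char phi)%:R^-1 * z) = (char phi)%:R^-1 * normc z.
  by rewrite normcM normcV normc_nat.
have half z t : normc z <= t -> normc ((char phi)%:R^-1 * z) <= t / 2.
  move=> zt; rewrite nc mulrC ler_pM ?normc_ge0 ?invr_ge0 ?(ltW cR)//.
  by rewrite lef_pV2 ?posrE.
have shiftX s z : K%:R < complex.Re s -> normc z <= B -> X%:R < complex.Re (s + z).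
  move=> Ks zB; rewrite ReD.
  have := le_trans (Re_le_normc z) zB; rewrite ler_norml => /andP[z1 _].
  by move: Ks; rewrite KE; lra.
pose v := linearizer_approx.
have vS j s : v j.+1 s = (char phi)%:R^-1 * (v j (c0 * s) - psi (s + v j s)) by [].
have vP j : bohr K%:R (v j) /\ forall s, K%:R < complex.Re s -> normc (v j s) <= B.
  elim: j => [|j [bj Bj]].
    by split=> [|s _]; [exact: bohr_cst|rewrite normc0].
  split=> [|s Ks].
    apply: bohrZ; apply: bohrD.
      have b0 := bohr_cst K%:R (0 : R[i]).
      have bd := bohr_comp K0 bj b0.
      apply: bohr_ext (bd (char phi) _) => [s _|s Ks]; first by rewrite addr0.
      by rewrite addr0; exact: dil.
    have bpsi := bohr_comp (c := 1) K0 (psi_bohr phi ltr01) bj.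
    apply: bohr_ext (bohrZ (-1) (bpsi _)) => [s _|s Ks].
      by rewrite mulN1r mul1r.
    rewrite mul1r; apply: lt_trans (shiftX _ _ Ks (Bj _ Ks)).
    by apply: lt_le_trans X2; rewrite ltr1n.
  have -> : B = (B + B) / 2 by field.
  apply: half; apply: le_trans (normcB _ _) _; rewrite lerD ?Bj ?dil//.
  by apply/psiB/ltW/(le_lt_trans X2)/shiftX/Bj.
have psiL' s z w : K%:R < complex.Re s -> normc z <= B -> normc w <= B ->
    normc (psi (s + z) - psi (s + w)) <= 2^-1 * normc (z - w).
  move=> Ks zB wB; have XX0 : (X0%:R : R) <= X%:R by rewrite ler_nat leq_maxr.
  have E : s + z - (s + w) = z - w by ring.
  rewrite -E; apply: psiL; rewrite ?E.
  - by apply/ltW/(le_lt_trans XX0)/shiftX.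
  - by apply/ltW/(le_lt_trans XX0)/shiftX.
  - apply: le_trans (normcB _ _) _.
    by rewrite -addnn natrD lerD.
have step j s : K%:R < complex.Re s -> normc (v j.+1 s - v j s) <= B * (3 / 4) ^+ j.
  elim: j s => [|j IH] s Ks.
    by rewrite subr0 expr0 mulr1; exact: (vP 1).2.
  have -> : B * (3 / 4) ^+ j.+1 =
     (B * (3 / 4) ^+ j + 2^-1 * (B * (3 / 4) ^+ j)) / 2 by rewrite exprS; field.
  rewrite (vS j.+1 s) [X in _ - X](vS j s) -mulrBr; apply: half.
  rewrite (_ : _ - _ = (v j.+1 (c0 * s) - v j (c0 * s))
      - (psi (s + v j.+1 s) - psi (s + v j s))); last by rewrite !opprD !opprK addrACA.
  apply: le_trans (normcB _ _) _; rewrite lerD ?IH ?dil//.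
  apply: le_trans (psiL' _ _ _ Ks ((vP j.+1).2 _ Ks) ((vP j).2 _ Ks)) _.
  by rewrite ler_wpM2l ?(ltW h0)// IH.
have dist j l s : K%:R < complex.Re s -> (j <= l)%N ->
    normc (v l s - v j s) <= 4 * B * (3 / 4) ^+ j.
  move=> Ks jl; rewrite -(subnK jl) addnC; elim: (l - j)%N => [|m IH].
    by rewrite addn0 subrr normc0 !mulr_ge0// exprn_ge0// divr_ge0.
  suff : normc (v (j + m.+1)%N s - v j s)
      <= 4 * B * (3 / 4) ^+ j - 4 * B * (3 / 4) ^+ (j + m.+1).
    move/le_trans; apply; rewrite gerBl !mulr_ge0// exprn_ge0// divr_ge0.
  elim: m {IH} => [|m IH].
    rewrite addn1; apply: le_trans (step _ _ Ks) _.
    by rewrite exprS le_eqVlt; apply/orP; left; apply/eqP; field.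
  apply: le_trans (normc_distD (v (j + m.+1)%N s) _ _) _.
  rewrite addnS; apply: le_trans (lerD (step _ _ Ks) IH) _.
  by rewrite [_ ^+ (j + m.+1).+1]exprS le_eqVlt; apply/orP; left; apply/eqP; field.
have small e : 0 < e -> exists N, forall n, (N <= n)%N -> 4 * B * (3 / 4) ^+ n <= e.
  move=> e0; have B4 : 0 < 4 * B + 1 by rewrite ltr_wpDl// mulr_ge0.
  have [N hN] := exp34_small (divr_gt0 e0 B4); exists N => n /hN hn.
  apply: le_trans (ler_wpM2l _ hn) _; first by rewrite mulr_ge0.
  by apply: mul_div_addr1_le (ltW e0); rewrite mulr_ge0.
have vlim s : exists w, K%:R < complex.Re s -> tends (fun j => v j s) w.
  have [Ks|Ks] := ltP K%:R (complex.Re s); last by exists 0.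
  have [|w hw] := @tends_complete _ (fun j => v j s); last by exists w.
  move=> e e0; have [N hN] := small _ (divr_gt0 e0 (ltr0n _ 2)).
  exists N => n m Nn Nm; apply: le_trans (normc_distD (v N s) _ _) _.
  rewrite [e]splitr lerD//.
    exact: le_trans (dist _ _ _ Ks Nn) (hN _ (leqnn _)).
  by rewrite normc_distC; exact: le_trans (dist _ _ _ Ks Nm) (hN _ (leqnn _)).
have {vlim}[w hw] := choice vlim.
have wB s : K%:R < complex.Re s -> normc (w s) <= B.
  move=> Ks; apply: tends_normc_le (hw s Ks) => j; exact: (vP j).2.
have wv j s : K%:R < complex.Re s -> normc (w s - v j s) <= 4 * B * (3 / 4) ^+ j.
  move=> Ks; apply/ler_addgt0Pr => e e0; have [N hN] := hw s Ks _ e0.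
  apply: le_trans (normc_distD (v (maxn N j) s) _ _) _.
  by rewrite addrC lerD ?dist ?leq_maxr// normc_distC hN// leq_maxl.
exists K, w; split=> [|s Ks|s Ks].
- apply: bohr_lim => e e0; have [N hN] := small _ e0.
  exists (v N) => [|s Ks]; first exact: (vP N).1.
  exact: le_trans (wv _ _ Ks) (hN _ (leqnn _)).
- by apply: le_lt_trans X2 _; apply: shiftX => //; exact: wB.
- have eq_w : w s = (char phi)%:R^-1 * (w (c0 * s) - psi (s + w s)).
    have t1 : tends (fun j => v j.+1 s) (w s).
      by move=> e e0; have [N hN] := hw s Ks _ e0; exists N => n Nn; exact/hN/leqW.
    apply: tends_uniq t1 _; apply: tendsZ; apply: tendsD; first by apply: hw; exact: dil.
    move=> e e0; have [N hN] := hw s Ks _ e0; exists N => n Nn.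
    rewrite opprK addrC; apply: le_trans (psiL' _ _ _ Ks (wB _ Ks) ((vP n).2 _ Ks)) _.
    apply: le_trans (_ : 1 * normc (w s - v n s) <= _).
      by rewrite ler_wpM2r ?normc_ge0// ltW.
    by rewrite mul1r normc_distC hN.
  have cC : c0 != 0 by rewrite pnatr_eq0 -lt0n ltnW.
  rewrite GfunE -/psi -/c0 mulrDr {1}eq_w mulrA divff// mul1r.
  by rewrite -addrA subrK.
Qed.

End Linearizer.

(** * The composition operator and its iterates *)

Section CompositionOperator.
Variables (R : realType) (phi : Gpos R) (A : bop R).
Hypothesis char2 : (2 <= char phi)%N.
Hypothesis AP : is_composition_operator phi A.
Implicit Types (x y e B : R) (s z : R[i]) (n m N K k : nat) (f g : H2 R).

Lemma comp_eval f s : 2 <= complex.Re s -> H2eval (A f) s = H2eval f (phi s).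
Proof.
move=> s2; apply: AP; apply: lt_le_trans s2.
by apply: (@lt_trans _ _ 1); rewrite ?invf_lt1 ?ltr1n.
Qed.

Lemma iter_comp_eval k f s : 2 <= complex.Re s ->
  H2eval (iter k A f) s = H2eval f (iter k phi s).
Proof.
elim: k s => [//|k IH] s s2.
have z2 : 2 <= complex.Re (phi s).
  apply: (le_trans s2); apply: Re_Gfun_ge_id; exact: lt_le_trans s2.
by rewrite iterS (comp_eval _ s2) (IH _ z2) [in RHS]iterSr.
Qed.

(** Since [c0 >= 2], [C_phi] strictly raises the first frequency of a series
without constant term: on [Re s = x] the image is [O((K+1)^(-2x))], and its
[m]-th coefficient is at most [(m+1)^x] times that. *)
Lemma comp_shift_support K f : (0 < K)%N -> (forall n, (n < K)%N -> f n = 0) ->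
  forall m, (m <= K)%N -> A f m = 0.
Proof.
move=> K0 fK m mK; apply/eq0_normc/eqP; rewrite eq_le normc_ge0 andbT.
apply/ler_addgt0Pr => e e0; rewrite add0r.
pose l : R := ln K.+1%:R; have l0 : 0 < l by rewrite ln_gt0// ltr1n.
have ml : ln m.+1%:R <= l by rewrite ler_ln ?posrE ?ltr0n// ler_nat.
set C := 2 * H2norm f; have C0 : 0 <= C by rewrite mulr_ge0 ?H2norm_ge0.
(* [x] is so large that [C exp (- (x - 2) l) <= e] *)
pose t := 1 + C / e; have t0 : 0 < t by rewrite ltr_pwDl// divr_ge0// ltW.
pose x := 2 + t / l; have x2 : 2 < x by rewrite ltrDl divr_gt0.
have fphi s : complex.Re s = x ->
    normc (H2eval (A f) s) <= C * expR (- ((2 * x - 2) * l)).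
  move=> sx; have s2 : 2 <= complex.Re s by rewrite sx ltW.
  have s0 : 0 < complex.Re s by apply: lt_le_trans s2.
  rewrite comp_eval//.
  have zx : 2 * x <= complex.Re (phi s).
    apply: le_trans (Re_Gfun_ge phi s0).
    by rewrite sx ler_wpM2r ?ler_nat// -sx ltW.
  have z2 : 2 <= complex.Re (phi s) by lra.
  have := dirichlet_sum_tail K (H2coef_le f) z2.
  rewrite /dirichlet_partial big_nat big1 => [|n /andP[_ nK]]; last by rewrite fK ?mul0r.
  rewrite subr0; move/le_trans; apply; rewrite ler_pM ?expR_ge0//.
  - by rewrite mulr_ge0 ?H2norm_ge0// divr_ge0 ?ler0n.
  - rewrite /C mulrC ler_wpM2r ?H2norm_ge0// ler_pdivrMr ?ltr0n//.
    by rewrite ler_peMr// ler1n.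
  - by rewrite ler_expR lerN2 ler_wpM2r ?(ltW l0)// lerD2r.
apply: le_trans (is_coef_bound fphi (is_coef_H2eval (A f) m x2)) _.
rewrite -mulrA -expRD.
have E : - ((2 * x - 2) * l) + x * ln m.+1%:R <= - t.
  have -> : - t = - ((2 * x - 2) * l) + x * l by rewrite /x; field; rewrite gt_eqF.
  by rewrite lerD2l ler_wpM2l//; lra.
apply: le_trans (ler_wpM2l C0 (_ : _ <= expR (- t))) _; first by rewrite ler_expR.
rewrite expRN ler_pdivrMr ?expR_gt0//.
apply: le_trans (ler_wpM2l (ltW e0) (expR_ge1Dx t)).
rewrite /t addrA mulrDr mulrCA divff ?mulr1 ?gt_eqF// lerDr.
by rewrite mulr_ge0// ltW.
Qed.

Lemma iter_comp_support K k : (0 < K)%N ->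
  forall m, (m < K + k)%N -> iter k A (H2mono R K) m = 0.
Proof.
move=> K0; elim: k => [|k IH] m mK.
  by rewrite H2monoE (_ : (m == K) = false)//; apply/negbTE; rewrite neq_ltn; lia.
rewrite iterS; apply: (@comp_shift_support (K + k)) => //; last by lia.
by rewrite addn_gt0 K0.
Qed.

(** The supremum of [N^(-phi^(k+1))] on the right half-plane dominates its norm
in [H^2]: Bessel's inequality on the lines [Re s = x], [x -> 0].  The symbol
enters through [Re phi^(k+1) >= c0^k eps]. *)
Lemma H2norm_iter_comp eps n k : 0 < eps ->
    phi @` half_plane 0 `<=` half_plane eps ->
  H2norm (iter k.+1 A (H2mono R n))
    <= expR (- (((char phi) ^ k)%:R * eps * ln n.+1%:R)).
Proof.
move=> eps0 hphi; set h := iter _ _ _; set B := expR _.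
pose F s := npow n.+1 (iter k.+1 phi s).
have bF x : 0 < x -> bohr x F.
  by move=> x0; apply: bohr_iter_Gfun => //; exact: bohr_npow.
have FB s : 0 < complex.Re s -> normc (F s) <= B.
  move=> s0; rewrite normc_npow ler_expR lerN2 ler_wpM2r ?ln_nat_ge0// iterSr.
  have e1 : eps < complex.Re (phi s) by apply: (hphi (phi s)); exists s.
  apply: le_trans (Re_iter_Gfun_ge phi k (lt_trans eps0 e1)).
  by rewrite ler_wpM2l ?ler0n// ltW.
have hF x : 0 < x -> forall m, is_coef x F m (h m).
  move=> x0 m; pose y := Num.min (x / 2) 1.
  have y0 : 0 < y by rewrite lt_min ltr01 andbT divr_gt0.
  have yx : y < x by rewrite gt_min; apply/orP; left; rewrite ltr_pdivrMr// ltr_pMr// ltr1n.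
  have y3 : y < 3 by rewrite gt_min; apply/orP; right; rewrite ltr1n.
  apply: (bohr_coef_line (bF y y0) y3 yx).
  apply: eq_is_coef (is_coef_H2eval h m (_ : 2 < 3)) => [s s3|].
    by rewrite /h iter_comp_eval ?s3 ?ler_nat// H2mono_eval.
  by rewrite ltr_nat.
apply: H2norm_le => [|L]; first exact: expR_ge0.
set S := \sum_(m < L) _.
have S0 : 0 <= S by apply: sumr_ge0 => m _; exact: sqr_ge0.
set l : R := ln L.+1%:R; have l0 : 0 <= l by exact: ln_nat_ge0.
apply/ler_addgt0Pr => e e0.
(* the weights [(m+1)^(-2x)], [m < L], are at least [1 - 2 x l] *)
pose x := e / (2 * (l * S + 1)).
have lS : 0 < l * S + 1 by rewrite ltr_wpDl// mulr_ge0.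
have x0 : 0 < x by rewrite divr_gt0// mulr_gt0.
have := @is_coef_bessel R x F h B L _ (hF x x0).
have FBx s : complex.Re s = x -> normc (F s) <= B by move=> sx; rewrite FB// sx.
move=> /(_ FBx) bes.
have : S * (1 - 2 * x * l) <= B ^+ 2.
  apply: le_trans bes; rewrite mulr_suml; apply: ler_sum => m _.
  rewrite ler_wpM2l ?sqr_ge0//; apply: le_trans (expR_ge1Dx _).
  rewrite lerD2l lerN2; apply: ler_wpM2l.
    by rewrite mulr_ge0// ltW.
  by rewrite /l ler_ln ?posrE ?ltr0n// ler_nat ltnS ltnW.
have : 2 * x * (l * S) <= e.
  have -> : 2 * x * (l * S) = (l * S) * (e / (l * S + 1)).
    by rewrite /x; field; rewrite gt_eqF.
  by apply: mul_div_addr1_le (ltW e0); rewrite mulr_ge0.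
by lra.
Qed.

(** The factor [2^(-s)] survives composition with [phi], since
[2^(-phi(s)) = 2^(-s) 2^(-(c0-1)s) 2^(-psi(s))]. *)
Lemma npow2_iter k : exists2 G, bohr 2 G & forall s, 2 < complex.Re s ->
  npow 2 (iter k phi s) = npow 2 s * G s.
Proof.
have two0 : (0 : R) <= 2 by [].
elim: k => [|k [G bG GP]].
  by exists (fun=> 1) => [|s _]; [exact: bohr_cst|rewrite mulr1].
exists (fun s => npow (2 ^ (char phi).-1) s *
  (npow 2 (dirichlet_sum (Gcoef phi) s) * G (phi s))).
  apply: bohrM => //; first by apply: bohr_npow; rewrite expn_gt0.
  apply: bohrM => //; last by apply: bohr_Gfun.
  by apply: bohr_npow_comp => //; exact: psi_bohr.
move=> s s2; rewrite iterSr GP; last first.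
  apply: (lt_le_trans s2); apply: Re_Gfun_ge_id.
  exact: lt_trans s2.
have E : npow 2 ((char phi)%:R * s) = npow 2 s * npow (2 ^ (char phi).-1) s.
  by rewrite -npowX// -npowM ?expn_gt0// -expnS prednK// ltnW.
by rewrite GfunE npowD E !mulrA.
Qed.

Lemma iter_comp_even k n : ~~ odd n -> iter k A (H2mono R 1) n = 0.
Proof.
move=> n2; have [G bG GP] := npow2_iter k.
have t3 : (2 : R) < 3 by rewrite ltr_nat.
apply: (@is_coef_shift0 R 2 3 G 2 n) => //; first by rewrite dvdn2 /= n2.
apply: eq_is_coef (is_coef_H2eval (iter k A (H2mono R 1)) n t3) => s s3.
by rewrite iter_comp_eval ?H2mono_eval ?s3 ?(ltW t3)// GP ?s3.
Qed.

End CompositionOperator.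

(** * The weak operator topology *)

Section WeakOperatorTopology.
Variable R : realType.

(** Matrix coefficients are continuous for the weak operator topology. *)
Lemma wot_closure_matrix_coef0 (S : set (wot R)) (f : H2 R) n (T : wot R) :
    (forall X : bop R, S X -> X f n = 0) -> closure S T -> (T : bop R) f n = 0.
Proof.
move=> S0 clT; apply/eqP/negPn/negP => Tn0.
pose ev (X : wot R) : R[i] := @matrix_coef R X (f, H2mono R n).
have cev : continuous ev.
  move=> X; apply: (@continuous_comp _ _ _ (@matrix_coef R : wot R -> _)
    (proj (f, H2mono R n)) X); first exact: initial_continuous.
  exact: proj_continuous.
have evE (X : bop R) : ev X = X f n by rewrite /ev /matrix_coef /= H2dot_mono.
have d0 : 0 < `|ev T| by rewrite normr_gt0 evE.
have /cvgrPdist_lt/(_ _ d0) nearT := cev T.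
have [X [SX]] := clT _ nearT.
by rewrite /= (evE X) S0// subr0 ltxx.
Qed.

End WeakOperatorTopology.

(** * The functionals dual to the linearization *)

Section DualFunctionals.
Variables (R : realType) (phi : Gpos R) (A : bop R).
Hypothesis char2 : (2 <= char phi)%N.
Hypothesis AP : is_composition_operator phi A.
Variables (K : nat) (v : R[i] -> R[i]).
Hypothesis bv : bohr K%:R v.
Hypothesis Re_v : forall s, K%:R < complex.Re s -> 2 < complex.Re (s + v s).
Hypothesis conj_v : forall s, K%:R < complex.Re s ->
  phi (s + v s) = (char phi)%:R * s + v ((char phi)%:R * s).
Implicit Types (f g : H2 R) (s : R[i]) (n k : nat).

Let x : R := K%:R + 1.
Let K0 : 0 <= K%:R :> R. Proof. exact: ler0n. Qed.
Let Kx : K%:R < x. Proof. by rewrite ltrDl. Qed.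

Definition pullback f s := H2eval f (s + v s).

(** [xget] names the coefficient of the pullback, which exists because the
pullback is in Bohr's class. *)
Definition pull_coef n f : R[i] := xget 0 [set c | is_coef x (pullback f) n c].

Lemma pullback_bohr f : bohr K%:R (pullback f).
Proof.
apply: bohr_ext (bohr_comp (c := 1) K0 (H2eval_bohr f) bv _) => [s _|s Ks].
  by rewrite mul1r.
by rewrite mul1r Re_v.
Qed.

Lemma pull_coefP n f : is_coef x (pullback f) n (pull_coef n f).
Proof.
have [a ha] := bohr_has_coef (pullback_bohr f).
have := xgetPex 0 (ex_intro _ _ (ha x n Kx) :
  exists c, [set c | is_coef x (pullback f) n c] c).
exact.
Qed.

Lemma pull_coefZD n c f g :
  pull_coef n (c *: f + g) = c * pull_coef n f + pull_coef n g.
Proof.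
apply: is_coef_uniq (pull_coefP n _) _.
apply: eq_is_coef (is_coefD (is_coefZ c (pull_coefP n f)) (pull_coefP n g)).
move=> s sx; rewrite /pullback H2evalZD// ltW// Re_v//.
by rewrite sx.
Qed.

Lemma pull_coef_le n f :
  normc (pull_coef n f) <= 2 * H2norm f * expR (x * ln n.+1%:R).
Proof.
apply: (is_coef_bound _ (pull_coefP n f)) => s sx.
by apply/H2eval_bounded/ltW/Re_v; rewrite sx.
Qed.

Lemma pullback_comp f s : complex.Re s = x ->
  pullback (A f) s = pullback f ((char phi)%:R * s).
Proof.
move=> sx; have Ks : K%:R < complex.Re s by rewrite sx.
by rewrite /pullback (comp_eval AP) ?(ltW (Re_v Ks))// conj_v.
Qed.

(** The conjugation [phi(s + v(s)) = c0 s + v(c0 s)] turns [C_phi] into the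
substitution of [c0 s] for [s], which moves the coefficient of [n^(-s)] to
[(n^c0)^(-s)] and leaves no other frequency. *)
Lemma pull_coef_comp n f :
  pull_coef (n.+1 ^ char phi).-1 (A f) = pull_coef n f.
Proof.
have c0 : (0 < char phi)%N by exact: ltnW.
apply: (is_coef_dilate c0 K0 Kx (pullback_bohr f) (pull_coefP n f)).
by apply: eq_is_coef (pull_coefP _ (A f)) => s sx; rewrite pullback_comp.
Qed.

Lemma pull_coef_comp0 n f : (forall j, (j.+1 ^ char phi)%N <> n.+1) ->
  pull_coef n (A f) = 0.
Proof.
move=> hn; have c0 : (0 < char phi)%N by exact: ltnW.
apply: (is_coef_dilate0 c0 hn K0 Kx (pullback_bohr f)).
by apply: eq_is_coef (pull_coefP _ (A f)) => s sx; rewrite pullback_comp.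
Qed.

(** [2^(-s-v(s)) = 2^(-s) exp(-v(s) log 2)], and the second factor has an inverse in
Bohr's class, hence a nonzero constant term. *)
Lemma pull_coef_mono : pull_coef 1 (H2mono R 1) != 0.
Proof.
apply/eqP => g0; have bE := bohr_npow_comp 2 K0 bv.
have bE' : bohr K%:R (fun s => npow 2 (- v s)).
  apply: (bohr_npow_comp 2 K0); apply: bohr_ext (bohrZ (-1) bv) => s _.
  by rewrite mulN1r.
have [a ha] := bohr_has_coef bE.
have a0 : a 0 = 0.
  have h : is_coef x (fun s => npow 2 s * npow 2 (v s)) (2 * 1).-1 0.
    rewrite -g0; apply: eq_is_coef (pull_coefP 1 (H2mono R 1)) => s _.
    by rewrite /pullback H2mono_eval npowD.
  by rewrite (is_coef_shift (d := 2) _ K0 Kx bE (ha _ 0 Kx) h).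
have E0 := ha _ 0 Kx; rewrite a0 in E0.
have one : is_coef x (fun s => npow 2 (v s) * npow 2 (- v s)) 0 1.
  apply: eq_is_coef (is_coef_npow x 0 0) => s _.
  by rewrite npow1 -npowD subrr npow0.
by have /eqP := is_coef0_ideal K0 Kx bE bE' E0 one; rewrite oner_eq0.
Qed.

(** The frequencies [2^(c0^k)] form an orbit of the map [n |-> n^c0] that starts at
a number which is not a [c0]-th power; so these functionals are a backward chain for
[C_phi], ending in 0. *)
Definition chain k f := pull_coef (2 ^ (char phi ^ k)).-1 f.

Lemma chainS k f : chain k.+1 (A f) = chain k f.
Proof.
by rewrite /chain -[RHS]pull_coef_comp prednK ?expn_gt0// -expnM -expnSr.
Qed.

Lemma chain0 f : chain 0 (A f) = 0.
Proof.
apply: pull_coef_comp0 => j; rewrite expn0 /=.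
case: j => [|j]; first by rewrite exp1n.
have : (2 ^ 2 <= j.+2 ^ char phi)%N.
  by apply: leq_trans (leq_pexp2l _ char2) _ => //; rewrite leq_exp2r// ltnW.
by case: (j.+2 ^ char phi)%N => [|[|[|]]].
Qed.

Lemma chain_le k f : normc (chain k f)
  <= 2 * H2norm f * expR ((char phi ^ k)%:R * (x * ln 2)).
Proof.
apply: le_trans (pull_coef_le _ _) _; rewrite prednK ?expn_gt0//.
by rewrite natrX lnXn// mulrnAr -[(x * ln 2) *+ _]mulr_natl.
Qed.

End DualFunctionals.

(** * A commuting operator *)

Section ChainOperator.
Variables (R : realType) (phi : Gpos R) (A : bop R).
Hypothesis char2 : (2 <= char phi)%N.
Hypothesis AP : is_composition_operator phi A.
Variables (g : nat -> H2 R -> R[i]) (n : nat) (D : R).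
Hypothesis n0 : (0 < n)%N.
Hypothesis D0 : 0 <= D.
Hypothesis gZD : forall k c f f', g k (c *: f + f') = c * g k f + g k f'.
Hypothesis gS : forall k f, g k.+1 (A f) = g k f.
Hypothesis g0 : forall f, g 0 (A f) = 0.
Hypothesis g_le : forall k f,
  normc (g k f) * H2norm (iter k A (H2mono R n)) <= D * H2norm f * (1 / 4) ^+ k.
Implicit Types (f : H2 R) (k m L M : nat).

Let u k : H2 R := iter k A (H2mono R n).

Let u_support k m : (m < n + k)%N -> u k m = 0.
Proof. exact: (iter_comp_support char2 AP n0). Qed.

Lemma sqr_normcD_le (z w : R[i]) :
  normc (z + w) ^+ 2 <= 2 * normc z ^+ 2 + 2 * normc w ^+ 2.
Proof.
apply: le_trans (_ : (normc z + normc w) ^+ 2 <= _).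
  by rewrite lerXn2r ?nnegrE ?addr_ge0 ?normc_ge0// le_normcD.
rewrite -subr_ge0 [X in 0 <= X](_ : _ = (normc z - normc w) ^+ 2); last by ring.
exact: sqr_ge0.
Qed.

(** Geometrically small terms can be summed in the square norm by
[|z+w|^2 <= 2|z|^2 + 2|w|^2] alone. *)
Lemma sum_geometric_sqr (w : nat -> nat -> R[i]) (B : R) L M :
    (forall k, \sum_(m < L) normc (w k m) ^+ 2 <= (B * (1 / 4) ^+ k) ^+ 2) ->
  \sum_(m < L) normc (\sum_(k < M) w k m) ^+ 2 <= (2 * B) ^+ 2.
Proof.
elim: M w B => [|M IH] w B wB.
  by rewrite big1 ?sqr_ge0// => m _; rewrite big_ord0 normc0 expr0n.
have w0 := wB 0; rewrite expr0 mulr1 in w0.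
have E : B / 4 = B * (1 / 4) by rewrite mul1r.
have /(IH (fun k => w k.+1)) h k :
    \sum_(m < L) normc (w k.+1 m) ^+ 2 <= (B / 4 * (1 / 4) ^+ k) ^+ 2.
  by apply: le_trans (wB k.+1) _; rewrite E -mulrA -exprS.
apply: le_trans (_ : 2 * B ^+ 2 + 2 * (2 * (B / 4)) ^+ 2 <= _).
  apply: le_trans (lerD (ler_wpM2l _ w0) (ler_wpM2l _ h)) => //.
  rewrite !mulr_sumr -big_split; apply: ler_sum => m _ /=.
  by rewrite big_ord_recl; exact: sqr_normcD_le.
rewrite -subr_ge0 [X in 0 <= X](_ : _ = 3 / 2 * B ^+ 2); last by field.
by rewrite mulr_ge0 ?sqr_ge0// divr_ge0.
Qed.

Lemma sum_ord_trunc (F : nat -> R[i]) m M : (m <= M)%N ->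
  (forall k, (m <= k)%N -> F k = 0) -> \sum_(k < m) F k = \sum_(k < M) F k.
Proof.
move=> mM F0; rewrite -(subnKC mM) big_split_ord /= [X in _ + X]big1 ?addr0//.
by move=> k _; rewrite F0// leq_addr.
Qed.

(** The series [sum_k g_k(f) A^k u]; by the growth of the supports its
coefficients are finite sums. *)
Definition chain_coef f m : R[i] := \sum_(k < m.+1) g k f * u k m.

Lemma chain_coefE f m M : (m < M)%N -> chain_coef f m = \sum_(k < M) g k f * u k m.
Proof.
move=> mM; apply: (sum_ord_trunc (F := fun k => g k f * u k m)) => // k mk.
by rewrite u_support ?mulr0//; lia.
Qed.

Lemma chain_coef_sqr f L :
  \sum_(m < L) normc (chain_coef f m) ^+ 2 <= (2 * (D * H2norm f)) ^+ 2.
Proof.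
rewrite (eq_bigr (fun m : 'I_L => normc (\sum_(k < L) g k f * u k m) ^+ 2)); last first.
  by move=> m _; rewrite (chain_coefE f (ltn_ord m)).
apply: (@sum_geometric_sqr (fun k m => g k f * u k m)) => k.
under eq_bigr do rewrite normcM exprMn.
rewrite -mulr_sumr; apply: le_trans (ler_wpM2l (sqr_ge0 _) (sqnorm_partial_le _ _)) _.
rewrite -exprMn lerXn2r ?nnegrE ?mulr_ge0 ?exprn_ge0 ?divr_ge0 ?normc_ge0 ?H2norm_ge0//.
Qed.

Definition chain_fun f : H2 R :=
  @MkH2 R (chain_coef f) (sqsummable_bounded (chain_coef_sqr f)).

Lemma chain_fun_is_linear : linear chain_fun.
Proof.
move=> c f f'; apply: H2eq => m; rewrite H2coefZD /= /chain_coef mulr_sumr -big_split.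
by apply: eq_bigr => k _ /=; rewrite gZD mulrDl mulrA.
Qed.

HB.instance Definition _ := GRing.isLinear.Build R[i] (H2 R) (H2 R) _ chain_fun
  chain_fun_is_linear.

Lemma chain_fun_bounded : exists M : R, forall f, H2norm (chain_fun f) <= M * H2norm f.
Proof.
exists (2 * D) => f; rewrite -mulrA; apply: H2norm_le; last exact: chain_coef_sqr.
by rewrite !mulr_ge0 ?H2norm_ge0.
Qed.

Definition chain_op : bop R := @MkBop R chain_fun chain_fun_bounded.

Lemma H2coef_sum (I : Type) (r : seq I) (F : I -> H2 R) m :
  (\sum_(i <- r) F i) m = \sum_(i <- r) F i m.
Proof.
elim: r => [|i r IH]; first by rewrite !big_nil.
by rewrite !big_cons -IH -[F i](scale1r) H2coefZD scale1r mul1r.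
Qed.

Lemma H2coefZ c f m : (c *: f) m = c * f m.
Proof. by []. Qed.

(** Only finitely many terms of the series reach a given coefficient, before and
after applying [A]; on those terms the chain relations say that [T A = A T]. *)
Lemma chain_op_comm f : chain_op (A f) = A (chain_op f).
Proof.
apply: H2eq => m.
pose P := \sum_(k < m.+1) g k f *: u k.
have Pj j : P j = \sum_(k < m.+1) g k f * u k j by rewrite H2coef_sum.
have rest : A (-1 *: P + chain_op f) m = 0.
  apply: (comp_shift_support char2 AP (ltn0Sn m)) => // j jm.
  by rewrite H2coefZD Pj mulN1r /= (chain_coefE f jm) addNr.
have -> : A (chain_op f) m = A P m.
  by move: rest; rewrite linearP H2coefZD mulN1r addrC => /subr0_eq.
have -> : A P m = \sum_(k < m.+1) g k f * u k.+1 m.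
  rewrite linear_sum H2coef_sum; apply: eq_bigr => k _.
  by rewrite linearZ.
rewrite /= (@chain_coefE _ m m.+2)// big_ord_recl g0 mul0r add0r.
by apply: eq_bigr => k _; rewrite gS.
Qed.

Lemma chain_op_coef f : chain_op f n = g 0 f.
Proof.
have trunc := @sum_ord_trunc (fun k => g k f * u k n) 1 n.+1 (ltn0Sn n).
rewrite /= /chain_coef -trunc => [|k k1]; last first.
  by rewrite u_support ?mulr0// -addn1 leq_add2l.
by rewrite big_ord1 /u /= eqxx mulr1.
Qed.

End ChainOperator.

(** * Failure of the minimal commutant property *)

Lemma H2norm_mono_le (R : realType) n : H2norm (H2mono R n) <= 1.
Proof.
apply: H2norm_le => // L; rewrite expr1n; exact: sum_delta_sqnorm.
Qed.

(** The competition between the two growth rates: [x log 2] comes from the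
functionals and [eps log (n+1)] from the iterates of the [n]-th monomial, both
multiplied by powers of the characteristic. *)
Lemma chain_decay (R : realType) (c k : nat) (x eps l : R) :
    (2 <= c)%N -> c%:R * (x * ln 2) + ln 4 <= eps * l ->
  expR ((c ^ k.+1)%:R * (x * ln 2)) * expR (- ((c ^ k)%:R * eps * l))
    <= (1 / 4) ^+ k.+1.
Proof.
move=> c2 xl; rewrite -expRD.
have c0 : (0 : R) <= (c ^ k)%:R by exact: ler0n.
have l4 : 0 <= ln 4 :> R by exact: ln_nat_ge0.
have -> : 1 / 4 = expR (- ln 4) :> R by rewrite mul1r expRN lnK// posrE.
rewrite -expRM_natl ler_expR.
apply: le_trans (_ : (c ^ k)%:R * - ln 4 <= _).
  have := ler_wpM2l c0 xl; rewrite expnS natrM.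
  move: (c ^ k)%:R (c%:R : R) (x * ln 2) => a b d; nra.
rewrite !mulrN lerN2 ler_wpM2r// ler_nat.
exact: ltn_expl.
Qed.

Theorem theorem1p2 (R : realType) (phi : Gpos R)
  (hchar : (2 <= char phi)%N)
  (heps : exists eps : R,
     0 < eps /\ phi @` half_plane 0 `<=` half_plane eps)
  (Cphi : bop R) (hCphi : is_composition_operator phi Cphi) :
  ~ minimal_commutant Cphi.
Proof.
have [eps [eps0 hphi]] := heps.
have [K [v [bv Re_v conj_v]]] := exists_linearizer hchar.
pose x : R := K%:R + 1.
pose g := chain phi K v.
pose t : R := ((char phi)%:R * (x * ln 2) + ln 4) / eps.
(* an odd integer [n + 1], so that the frequency [n + 1] is missed by every power
   of [Cphi] on [2^(-s)], and so large that the series for [T] converges *)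
pose n := (Num.truncn (expR t)).+1.*2.
have n0 : (0 < n)%N by rewrite double_gt0.
have tn : (char phi)%:R * (x * ln 2) + ln 4 <= eps * ln n.+1%:R.
  rewrite [eps * _]mulrC -ler_pdivrMr// -/t -[t]expRK ler_ln ?posrE ?expR_gt0 ?ltr0n//.
  apply: le_trans (ltW (truncnS_gt _)) _; rewrite ler_nat /n -addnn.
  by rewrite -addnS leq_addr.
have x20 : 0 <= x * ln 2 by rewrite mulr_ge0 ?ln_nat_ge0// addr_ge0.
pose D := 2 * expR (x * ln 2).
have D0 : 0 <= D by rewrite mulr_ge0// expR_ge0.
have g_le k f : normc (g k f) * H2norm (iter k Cphi (H2mono R n))
    <= D * H2norm f * (1 / 4) ^+ k.
  have gk := chain_le phi bv Re_v k f.
  case: k gk => [|k] gk.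
    rewrite expr0 mulr1; apply: le_trans (ler_pM _ _ gk (H2norm_mono_le R n)) _.
    - exact: normc_ge0.
    - exact: H2norm_ge0.
    rewrite expn0 mulr1 /D [leRHS]mulrAC mul1r; exact: lexx.
  apply: le_trans (ler_pM _ _ gk (H2norm_iter_comp hCphi n k eps0 hphi)) _.
  - exact: normc_ge0.
  - exact: H2norm_ge0.
  rewrite -[leLHS]mulrA; apply: ler_pM.
  - by rewrite mulr_ge0 ?H2norm_ge0.
  - by rewrite mulr_ge0 ?expR_ge0.
  - rewrite ler_wpM2r ?H2norm_ge0// /D ler_peMr// -[leLHS]expR0 ler_expR//.
  - exact: chain_decay.
have gZD k c f f' : g k (c *: f + f') = c * g k f + g k f'.
  exact: pull_coefZD.
have gS k f : g k.+1 (Cphi f) = g k f by exact: chainS.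
have g0 f : g 0 (Cphi f) = 0 by exact: chain0.
pose T := chain_op hchar hCphi n0 D0 gZD g_le.
have Tcomm : commutant Cphi T by move=> f; exact: chain_op_comm.
move=> min_comm; rewrite /minimal_commutant in min_comm.
have Tcl : closure (alg Cphi) T by rewrite min_comm.
have T0 : T (H2mono R 1) n = 0.
  apply: wot_closure_matrix_coef0 Tcl => X [p Xp].
  rewrite Xp H2coef_sum big1// => k _; rewrite H2coefZ.
  by rewrite (iter_comp_even hchar hCphi) ?mulr0// odd_double.
have := pull_coef_mono bv Re_v.
by move: T0; rewrite chain_op_coef /g /chain expn0 => ->; rewrite eqxx.
Qed.
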